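(* Let $(X_t)_{t\ge 0}$ be a conservative continuous-time Markov process on a Polish space $E$ with invariant probability measure $\mu$, and let $L$ be the generator on $L^2(\mu)$ of its semigroup $(P_t)_{t\ge0}$, closed with domain $D(L)$ dense in $L^2(\mu)$. Assume that there exist $\rho>0$ and a bounded symmetric linear operator $S$ on $L^2(\mu)$ such that for all $f\in D(L)$, $$\|Sf\|_2\le \tfrac12\|f-\mu f\|_2,\qquad \langle f, Lf+SLf\rangle\le -\rho\,\|f-\mu f\|_2^2 .$$ Let $U$ be a measurable subset of $E$, let $T_U=\inf\{t\ge 0:\ X_t\in U\}$, and let $$h(r)=\frac{\rho\, r^2}{25\|V\|_2^2+6\|V\|_\infty r}\qquad\text{with } V=-\mathbf{1}_U .$$ If $\mu(U)>0$, then for all $\theta<h(\mu(U))$ and every probability measure $\nu\ll\mu$ on $E$, $$\mathbb{E}_\nu\left(e^{\theta T_U}\right)\le 1+\sqrt2\,\left\|\frac{d\nu}{d\mu}\right\|_2\frac{\theta}{h(\mu(U))-\theta}.$$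
   Context: $\|\cdot\|_2$ and $\langle\cdot,\cdot\rangle$ denote the usual norm and scalar product of $L^2(\mu)$; $\|\cdot\|_\infty$ is the sup norm; $\mu f=\int_E f\,d\mu$; $\mathbf{1}_U$ is the indicator function of $U$. The semigroup is $P_tf(x)=\mathbb{E}_x(f(X_t))$, where the index $x$ is the initial condition of the process, regarded as a semigroup on $L^2(\mu)$, and conservative means $P_t\mathbf{1}=\mathbf{1}$. $\mathbb{E}_\nu$ is the expectation for the process with initial distribution $\nu$. $T_U$ is the first hitting time of $U$ by the process.
   Formalization: The bound is stated for 0 ≤ θ < h(μ(U)) only; for θ < 0 the claim fails, e.g. U = E gives T_U = 0 and left side 1, while the right side is below 1 when the L² norm of dν/dμ is finite. *)

(* Defs.v *)
From HB Require Import structures.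
From mathcomp Require Import all_boot all_order all_algebra.
From mathcomp Require Import all_classical all_reals all_analysis.
From mathcomp Require Import measurable_realfun.
Set Implicit Arguments.
Unset Strict Implicit.
Unset Printing Implicit Defensive.
Import Order.TTheory GRing.Theory Num.Theory.
Import numFieldNormedType.Exports.

Local Open Scope classical_set_scope.
Local Open Scope ring_scope.

Section polish.
Context (R : realType) (E : topologicalType).

Definition complete_metric (d : E -> E -> R) : Prop :=
  [/\ (forall x y, d x y = 0 <-> x = y),
      (forall x y, d x y = d y x),
      (forall x y z, d x z <= d x y + d y z) &
      (forall u : nat -> E,
        (forall e, 0 < e -> exists N : nat, forall m n : nat,
           (N <= m)%N -> (N <= n)%N -> d (u m) (u n) < e) ->
        exists l, forall e, 0 < e -> exists N : nat, forall n : nat,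
           (N <= n)%N -> d (u n) l < e)].

Definition metrizes (d : E -> E -> R) : Prop :=
  forall (x : E) (A : set E),
    nbhs x A <-> exists2 e, 0 < e & [set y | d x y < e] `<=` A.

Definition polish : Prop :=
  (exists2 D : set E, countable D & dense D) /\
  exists d, complete_metric d /\ metrizes d.

End polish.

Definition borel (E : ptopologicalType) := g_sigma_algebraType (@open E).

(* The process is given in its canonical form: one measurable space Omega
   carrying all the random variables X t (only the times t >= 0 matter),
   together with the laws P x of the process started at x. Since X t takes its
   values in E and every P x has total mass 1, the process is conservative (see
   transition_semigroup_cst1 below). *)
Section markov_process.
Context (R : realType) (dE dO : measure_display) (E : measurableType dE)
  (Omega : measurableType dO) (X : R -> Omega -> E) (P : R.-pker E ~> Omega).

Definition natural_filtration (s : R) : set (set Omega) :=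
  <<s [set A | exists u B,
        [/\ 0 <= u <= s, measurable B & A = X u @^-1` B]] >>.

(* The third field is P_x(X_{s+t} \in B | F_s) = P_{X_s}(X_t \in B), with the
   conditional probability spelled out. *)
Record markov_process : Prop := MarkovProcess {
  markov_measurable : forall t, 0 <= t -> measurable_fun setT (X t) ;
  markov_initial : forall x, \forall w \ae P x, X 0 w = x ;
  markov_property : forall x s t A B, 0 <= s -> 0 <= t ->
    natural_filtration s A -> measurable B ->
    P x (A `&` X (s + t) @^-1` B) =
      (\int[P x]_(w in A) P (X s w) (X t @^-1` B))%E }.

(* E_x(f(X_t)); for f in L^2 of an invariant measure it is well-defined for almost
   every x only, and the integral is 0 by convention when it is not finite. *)
Definition transition_semigroup (t : R) (f : E -> R) (x : E) : R :=
  \int[P x]_w f (X t w).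

Lemma transition_semigroup_cst1 t x : transition_semigroup t (cst 1) x = 1.
Proof.
rewrite /transition_semigroup /Rintegral (_ : (\int[P x]_w _ = 1)%E)//=.
by rewrite -[RHS](@prob_kernel _ _ _ _ _ P x) -[RHS]mul1e -integral_cst.
Qed.

Definition invariant_measure (mu : probability E R) : Prop :=
  forall t A, 0 <= t -> measurable A ->
    (\int[mu]_x P x (X t @^-1` A))%E = mu A.

Definition hitting_time (U : set E) (w : Omega) : \bar R :=
  ereal_inf [set t%:E | t in [set t | 0 <= t /\ U (X t w)]].

End markov_process.

Section start.
Context (R : realType) (dE dO : measure_display) (E : measurableType dE)
  (Omega : measurableType dO) (nu : {measure set E -> \bar R})
  (P : R.-pker E ~> Omega).
Local Open Scope ereal_scope.

(* the law of the process with initial distribution nu *)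
Definition started_from (A : set Omega) : \bar R := \int[nu]_x P x A.

Let started_from0 : started_from set0 = 0.
Proof. by rewrite /started_from integral0_eq. Qed.

Let started_from_ge0 A : 0 <= started_from A.
Proof. exact: integral_ge0. Qed.

Let started_from_sigma_additive : semi_sigma_additive started_from.
Proof.
move=> U mU tU mUU; rewrite [X in _ --> X](_ : _ =
  \int[nu]_x (\sum_(n <oo) P x (U n))); last first.
  apply: eq_integral => x _.
  by apply/esym/cvg_lim => //; exact/measure_semi_sigma_additive.
apply/cvg_closeP; split.
  by apply: is_cvg_nneseries => n _ _; exact: integral_ge0.
rewrite closeE// integral_nneseries// => n.
exact: measurable_kernel.
Qed.

HB.instance Definition _ := isMeasure.Build _ _ _ started_from
  started_from0 started_from_ge0 started_from_sigma_additive.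

End start.

(* The hitting time of a measurable set need not be measurable, so the
   expectation of a nonnegative function of it is taken as an upper integral. It
   coincides with the integral on measurable functions (upper_integralE). *)
Section upper_integral.
Context (R : realType) (dO : measure_display) (Omega : measurableType dO)
  (Q : {measure set Omega -> \bar R}).
Local Open Scope ereal_scope.

Definition upper_integral (Y : Omega -> \bar R) : \bar R :=
  ereal_inf [set \int[Q]_w Z w | Z in
    [set Z | measurable_fun setT Z /\ forall w, Y w <= Z w]].

Lemma upper_integralE (Y : Omega -> \bar R) :
  measurable_fun setT Y -> (forall w, 0 <= Y w) ->
  upper_integral Y = \int[Q]_w Y w.
Proof.
move=> mY Y0; apply/eqP; rewrite eq_le; apply/andP; split.
  by apply: ereal_inf_lbound; exists Y.
apply: le_ereal_inf_tmp => _ [Z [mZ YZ] <-].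
by apply: ge0_le_integral => // w _; exact: le_trans (Y0 w) (YZ w).
Qed.

End upper_integral.

(* Elements of L^2(mu) are represented by square-integrable functions, and
   operators on L^2(mu) by operations on these representatives that are
   compatible with almost everywhere equality. *)
Section L2.
Context (R : realType) (dE : measure_display) (E : measurableType dE)
  (mu : probability E R).

Definition L2 := LfunType mu (lee1n 2).

Definition norm2 (f : E -> R) : \bar R := 'N[mu]_2%:E[EFin \o f]%E.

Definition dot (f g : E -> R) : R := \int[mu]_x (f x * g x).

Definition mean (f : E -> R) : R := \int[mu]_x f x.

Definition centered (f : E -> R) (x : E) : R := f x - mean f.

Record linear_operator (S : L2 -> L2) : Prop := LinearOperator {
  operator_ae : forall f g : L2, f = g %[ae mu] -> S f = S g %[ae mu] ;
  operator_linear : forall (a : R) (f g : L2),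
    S (a *: f + g) = a *: S f + S g %[ae mu] }.

Definition bounded_operator (S : L2 -> L2) : Prop :=
  exists C : R, forall f : L2, (norm2 (S f) <= C%:E * norm2 f)%E.

Definition symmetric_operator (S : L2 -> L2) : Prop :=
  forall f g : L2, dot (S f) g = dot f (S g).

(* Unbounded operators are given by their graph: G f g means that f is in the
   domain of the operator and g is its image. *)
Definition dense_domain (G : L2 -> L2 -> Prop) : Prop :=
  forall (f : L2) (e : R), 0 < e ->
    exists f' g' : L2, G f' g' /\ (norm2 (f - f')%R < e%:E)%E.

Definition closed_graph (G : L2 -> L2 -> Prop) : Prop :=
  forall (f_ g_ : nat -> L2) (f g : L2),
    (forall n, G (f_ n) (g_ n)) ->
    norm2 (f_ n - f) @[n --> \oo] --> 0%E ->
    norm2 (g_ n - g) @[n --> \oo] --> 0%E -> G f g.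

End L2.

Definition L2_generator (R : realType) (dE dO : measure_display)
    (E : measurableType dE) (Omega : measurableType dO)
    (X : R -> Omega -> E) (P : R.-pker E ~> Omega) (mu : probability E R)
    (f Lf : L2 mu) : Prop :=
  norm2 mu (fun x => t^-1 * (transition_semigroup X P t f x - f x) - Lf x)
    @[t --> 0^'+] --> 0%E.

Arguments L2_generator {R dE dO E Omega} X P mu f Lf.

Definition sup_norm (R : realType) (E : Type) (f : E -> R) : R :=
  sup [set `|f x| | x in setT].

Definition rate (R : realType) (dE : measure_display) (E : measurableType dE)
    (mu : probability E R) (rho : R) (V : E -> R) (r : R) : R :=
  rho * r ^+ 2 /
    (25 * fine (norm2 mu V) ^+ 2 + 6 * sup_norm V * r).

(* Main.v *)
Require Import Defs.
From HB Require Import structures.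
From mathcomp Require Import all_boot all_order all_algebra.
From mathcomp Require Import all_classical all_reals all_analysis.
From mathcomp Require Import measurable_realfun ring lra.
Import Order.TTheory GRing.Theory Num.Theory.
Import numFieldNormedType.Exports.

Local Open Scope classical_set_scope.
Local Open Scope ring_scope.
Local Open Scope charge_scope.

Set Implicit Arguments.
Unset Strict Implicit.
Unset Printing Implicit Defensive.

(** Put r = mu(U); the rate is rho r / 31. It suffices to observe the process at
    the times 0, h, 2h, ... with h = 3 / rho: the first of these times at which it
    is in U is at least T_U, and its exponential moment is a series in the
    survival probabilities P_nu(X_0, ..., X_{kh} all outside U). By the Markov
    property (probability_survival) such a probability is the nu-mean of
    (1_{U^c} P_h)^k 1_{U^c} = (1_{U^c} P_h)^(k+1) 1, hence at most the L2(mu)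
    norm of this function times that of the density (started_from_survival). So
    everything rests on the operator norm of 1_{U^c} P_h, which is at most
    1 / (1 + r / 8) (killedL2_contraction), for two reasons.

    First, P_h halves the norm of centred functions (hypocoercive_contraction).
    The perturbed form b(f, g) = <f, g> + <Sf, g> lies between 1/2 and 3/2 of the
    inner product, and along the semigroup the derivative of b(f, f), which is
    2 <f, Lf + SLf>, is at most - 2 rho |f - mu f|^2. Since |P_t f - mu f|
    decreases in t, this gives
    b(P_t f, P_t f) + 2 rho t |P_t f - mu f|^2 <= b(f, f)
    (generator_energy_decay). No derivative is taken: the inequality is the limit
    of the same computation for Euler steps, whose errors are uniform along an
    orbit (residual_semigroup).

    Second, killing in U is felt by the remaining direction, the constants: a
    function with mean m that is small on U, relatively to m, has a large centred
    part, since |m| sqrt r is at most the norm of its restriction to U plus the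
    norm of its centred part (mean_le_restrict, killed_step_bound).

    With q = 1 / (1 + r / 8), the series is then geometric and its sum is below
    theta / (rho r / 31 - theta) (hitting_series_le). *)

(** * Integration against a mixture of measures *)

Section disintegration.
Context (R : realType) (d1 d2 d3 d4 : measure_display) (T : measurableType d1)
  (Y : measurableType d2) (W : measurableType d3) (Z : measurableType d4).
Import HBNNSimple.
Local Open Scope ereal_scope.

Lemma integral_comp_nnsfun d (V : measurableType d)
    (nu : {measure set V -> \bar R}) (A : set V) (phi : V -> Z)
    (g : {nnsfun Z >-> R}) : measurable A -> measurable_fun setT phi ->
  \int[nu]_(x in A) (g (phi x))%:E =
  \sum_(r \in range g) r%:E * nu (phi @^-1` (g @^-1` [set r]) `&` A).
Proof.
move=> mA mphi.
have mB r : measurable (phi @^-1` (g @^-1` [set r])).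
  by rewrite -[X in measurable X]setTI; exact: mphi.
under eq_integral do rewrite fimfunE -fsumEFin//.
rewrite ge0_integral_fsum//; last 2 first.
- move=> r; apply/measurable_EFinP/measurable_funM => //.
  apply: measurable_funTS.
  exact: (measurable_indic (mB r)).
- by move=> r z _; rewrite EFinM nnfun_muleindic_ge0.
apply: eq_fsbigr => r /set_mem [z _ <-].
under eq_integral do rewrite EFinM.
rewrite ge0_integralZl//; first last.
- by rewrite lee_fin.
- apply/measurable_EFinP/measurable_funTS; exact: (measurable_indic (mB (g z))).
by congr (_ * _); rewrite (integral_indic nu mA (mB (g z))).
Qed.

(** Both sides are monotone limits of their values at simple functions, and for
    the indicator of B they agree by hypothesis. Stationarity of mu and the
    Markov property are such hypotheses, stated on sets; this carries them over
    to functions. *)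
Lemma ge0_integral_disintegration (nu : {measure set T -> \bar R})
    (m : {measure set Y -> \bar R}) (k : Y -> {measure set W -> \bar R})
    (A : set T) (D : set Y) (phi : T -> Z) (psi : W -> Z) (f : Z -> \bar R) :
  measurable A -> measurable D ->
  measurable_fun setT phi -> measurable_fun setT psi ->
  (forall B, measurable B -> measurable_fun setT (fun y => k y B)) ->
  (forall B, measurable B ->
     nu (phi @^-1` B `&` A) = \int[m]_(y in D) k y (psi @^-1` B)) ->
  measurable_fun setT f -> (forall z, 0 <= f z) ->
  \int[nu]_(x in A) f (phi x) = \int[m]_(y in D) \int[k y]_w f (psi w).
Proof.
move=> mA mD mphi mpsi mk nuE mf f0.
pose g := nnsfun_approx measurableT mf.
have gf z : (g n z)%:E @[n --> \oo] --> f z by exact: cvg_nnsfun_approx.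
have nd z : {homo (fun n => (g n z)%:E) : a b / (a <= b)%N >-> a <= b}.
  by move=> a b ab; rewrite lee_fin; exact/lefP/nd_nnsfun_approx.
have mg n : measurable_fun setT (fun z => (g n z)%:E) by exact/measurable_EFinP.
have mgpsi n : measurable_fun setT (fun w => (g n (psi w))%:E).
  exact: (measurableT_comp (mg n) mpsi).
have mkint h : measurable_fun setT h -> (forall w, 0 <= h w) ->
    measurable_fun D (fun y => \int[k y]_w h w).
  by move=> mh h0; apply/measurable_funTS/measurable_fun_integral_kernel.
have inner y : \int[k y]_w f (psi w) =
    limn (fun n => \int[k y]_w (g n (psi w))%:E).
  rewrite -monotone_convergence//.
  - by apply: eq_integral => w _; apply/esym/cvg_lim.
  - by move=> n w _; rewrite lee_fin.
transitivity (limn (fun n => \int[nu]_(x in A) (g n (phi x))%:E)).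
  rewrite -monotone_convergence//.
  - by apply: eq_integral => w _; apply/esym/cvg_lim.
  - by move=> n; apply/measurable_funTS; exact: (measurableT_comp (mg n) mphi).
  - by move=> n x _; rewrite lee_fin.
under [RHS]eq_integral do rewrite inner.
rewrite [RHS]monotone_convergence//; first last.
- move=> y _ a b ab; apply: ge0_le_integral => //.
  + by move=> w _; rewrite lee_fin.
  + by move=> w _; exact: (nd (psi w)) ab.
- by move=> n y _; apply: integral_ge0 => w _; rewrite lee_fin.
- by move=> n; apply: mkint => // w; rewrite lee_fin.
congr (limn _); apply/funext => n.
rewrite integral_comp_nnsfun//.
under [RHS]eq_integral do rewrite integral_comp_nnsfun//.
have mB r : measurable (psi @^-1` (g n @^-1` [set r])).
  by rewrite -[X in measurable X]setTI; exact: mpsi.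
rewrite ge0_integral_fsum//; last 2 first.
- move=> r; apply: measurable_funeM; apply: measurable_funTS.
  by rewrite setIT; exact: mk.
- move=> r y _; have [r0|r0] := leP 0%R r; first by rewrite mule_ge0.
  by rewrite preimage_nnfun0// preimage_set0 set0I measure0 mule0.
apply: eq_fsbigr => r /set_mem [z _ <-].
rewrite ge0_integralZl//; last 2 first.
- by apply: measurable_funTS; rewrite setIT; exact: mk.
- by rewrite lee_fin.
by rewrite nuE//; congr (_ * _); apply: eq_integral => y _; rewrite setIT.
Qed.

Section signed.
Context (nu : {measure set T -> \bar R}) (m : {measure set Y -> \bar R})
  (k : Y -> {measure set W -> \bar R}) (phi : T -> Z) (psi : W -> Z).
Hypotheses (mphi : measurable_fun setT phi) (mpsi : measurable_fun setT psi)
  (mk : forall B, measurable B -> measurable_fun setT (fun y => k y B))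
  (nuE : forall B, measurable B ->
     nu (phi @^-1` B) = \int[m]_y k y (psi @^-1` B)).

Let disintegrate (g : Z -> \bar R) :
  measurable_fun setT g -> (forall z, 0 <= g z) ->
  \int[nu]_x g (phi x) = \int[m]_y \int[k y]_w g (psi w).
Proof.
move=> mg g0; apply: ge0_integral_disintegration => // B mB.
by rewrite setIT nuE.
Qed.

Let mint (g : Z -> \bar R) : measurable_fun setT g -> (forall z, 0 <= g z) ->
  measurable_fun setT (fun y => \int[k y]_w g (psi w)).
Proof.
move=> mg g0; apply: measurable_fun_integral_kernel => //.
exact: measurableT_comp mg mpsi.
Qed.

Lemma ae_integrable_disintegration (f : Z -> R) : measurable_fun setT f ->
  nu.-integrable setT (fun x => (f (phi x))%:E) ->
  \forall y \ae m, (k y).-integrable setT (fun w => (f (psi w))%:E).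
Proof.
move=> mf /integrableP[mfphi fy].
have mabs : measurable_fun setT (fun z => `|(f z)%:E|).
  by apply: measurableT_comp => //; exact/measurable_EFinP.
rewrite (disintegrate mabs) // in fy.
have : m.-integrable setT (fun y => \int[k y]_w `|(f (psi w))%:E|).
  apply/integrableP; split; first exact: (mint mabs).
  under eq_integral do rewrite gee0_abs ?integral_ge0//; exact: fy.
move/(integrable_ae measurableT); apply: filterS => y /(_ I) fin.
apply/integrableP; split.
  apply/measurable_EFinP; exact: measurableT_comp mf mpsi.
by move: fin; rewrite ge0_fin_numE// integral_ge0.
Qed.

(** For signed f the inner integral is meaningful for m-almost every y only;
    elsewhere the real-valued integral takes its default value 0, which does
    not affect the outer one. *)
Lemma integral_disintegration (f : Z -> R) : measurable_fun setT f ->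
  nu.-integrable setT (fun x => (f (phi x))%:E) ->
  \int[nu]_x (f (phi x))%:E = \int[m]_y (Rintegral (k y) setT (f \o psi))%:E.
Proof.
move=> mf fi; pose F := EFin \o f.
have mF : measurable_fun setT F by exact/measurable_EFinP.
have mFp := measurable_funepos mF; have mFn := measurable_funeneg mF.
have kE y : \int[k y]_w ((f \o psi) w)%:E =
    \int[k y]_w F^\+ (psi w) - \int[k y]_w F^\- (psi w).
  rewrite integralE; congr (_ - _); apply: eq_integral => w _.
    by rewrite !funeposE.
  by rewrite !funenegE.
rewrite integralE.
have -> : \int[nu]_x ((fun x0 => (f (phi x0))%:E)^\+ x) =
    \int[m]_y \int[k y]_w F^\+ (psi w).
  rewrite -(disintegrate mFp)//; apply: eq_integral => x _.
  by rewrite !funeposE.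
have -> : \int[nu]_x ((fun x0 => (f (phi x0))%:E)^\- x) =
    \int[m]_y \int[k y]_w F^\- (psi w).
  rewrite -(disintegrate mFn)//; apply: eq_integral => x _.
  by rewrite !funenegE.
have fin (g : Z -> \bar R) : measurable_fun setT g -> (forall z, 0 <= g z) ->
    nu.-integrable setT (g \o phi) ->
    m.-integrable setT (fun y => \int[k y]_w g (psi w)).
  move=> mg g0 /integrableP[_ gi]; apply/integrableP; split; first exact: mint.
  under eq_integral do rewrite gee0_abs ?integral_ge0//.
  rewrite -disintegrate//.
  apply: le_lt_trans gi; rewrite le_eqVlt; apply/orP; left; apply/eqP.
  by apply: eq_integral => x _; rewrite /= gee0_abs.
rewrite -integralB//; last 2 first.
- apply: fin => //.
  rewrite (_ : _ \o _ = (fun x => (f (phi x))%:E)^\+).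
    exact: integrable_funepos.
  by apply/funext => x; rewrite /= !funeposE.
- apply: fin => //.
  rewrite (_ : _ \o _ = (fun x => (f (phi x))%:E)^\-).
    exact: integrable_funeneg.
  by apply/funext => x; rewrite /= !funenegE.
apply: ae_eq_integral => //.
- by apply: emeasurable_funB; [apply: (mint mFp)|apply: (mint mFn)].
- apply/measurable_EFinP; apply: measurableT_comp; first exact: fine_measurable.
  under eq_fun do rewrite kE.
  by apply: emeasurable_funB; [apply: (mint mFp)|apply: (mint mFn)].
apply: filterS (ae_integrable_disintegration mf fi) => y ki _.
rewrite /Rintegral fineK; first by rewrite kE.
exact: (integrable_fin_num measurableT ki).
Qed.

End signed.

End disintegration.

(** * Positive semidefinite forms and their perturbation by an operator *)

(** Locked, as are the inner product, the centring, the semigroup and the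
    restriction on L2 below: unfolding them down to integrals makes the
    comparison of two different norms intractable. *)
HB.lock Definition form_norm {R : realType} {V : lmodType R}
  (b : V -> V -> R) (f : V) : R := Num.sqrt (b f f).

Section inner_form.
Context (R : realType) (V : lmodType R).

(** Only semidefinite, since functions that vanish almost everywhere have norm
    0. *)
Record inner_form (b : V -> V -> R) : Prop := InnerForm {
  inner_formC : forall f g, b f g = b g f ;
  form_linear : forall a f g h, b (a *: f + g) h = a * b f h + b g h ;
  form_ge0 : forall f, 0 <= b f f }.

Context (b : V -> V -> R) (ipb : inner_form b).
Local Notation N := (form_norm b).

Lemma form_normE f : N f = Num.sqrt (b f f).
Proof. by rewrite form_norm.unlock. Qed.

Lemma form_norm_ge0 f : 0 <= N f.
Proof. by rewrite form_normE sqrtr_ge0. Qed.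

Lemma sqr_form_norm f : N f ^+ 2 = b f f.
Proof. by rewrite form_normE sqr_sqrtr// form_ge0. Qed.

Lemma form_norm_le f g : b f f <= b g g -> N f <= N g.
Proof. by rewrite !form_normE => /ler_wsqrtr. Qed.

Lemma inner_formDl f g h : b (f + g) h = b f h + b g h.
Proof. by have := form_linear ipb 1 f g h; rewrite scale1r mul1r. Qed.

Lemma inner_form0l h : b 0 h = 0.
Proof. by have := inner_formDl 0 0 h; rewrite addr0; lra. Qed.

Lemma inner_formZl a f h : b (a *: f) h = a * b f h.
Proof.
by have := form_linear ipb a f 0 h; rewrite !addr0 inner_form0l addr0.
Qed.

Lemma inner_formDr f g h : b h (f + g) = b h f + b h g.
Proof. by rewrite !(inner_formC ipb h) inner_formDl. Qed.

Lemma inner_formZr a f h : b h (a *: f) = a * b h f.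
Proof. by rewrite !(inner_formC ipb h) inner_formZl. Qed.

Lemma form_sqrD f g a :
  b (f + a *: g) (f + a *: g) = b f f + 2 * a * b f g + a ^+ 2 * b g g.
Proof.
rewrite inner_formDl !inner_formDr !inner_formZl !inner_formZr.
by rewrite (inner_formC ipb g f); ring.
Qed.

(** Nonnegativity of the form at f + a g, with a minimizing the quadratic
    polynomial in a. *)
Lemma form_CauchySchwarz f g : `|b f g| <= N f * N g.
Proof.
rewrite -ler_sqr ?nnegrE ?mulr_ge0 ?form_norm_ge0//.
rewrite real_normK ?num_real// exprMn !sqr_form_norm.
have [g0|g0] := eqVneq (b g g) 0.
  (* the quadratic form is then affine and nonnegative along f + R g *)
  have [->|fg0] := eqVneq (b f g) 0; first by rewrite expr0n/= g0 mulr0.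
  have := form_ge0 ipb (f + (- (b f f + 1) / (2 * b f g)) *: g).
  rewrite form_sqrD g0 mulr0 addr0.
  rewrite (_ : 2 * _ * _ = - (b f f + 1)); last by field; rewrite fg0.
  by lra.
have gp : 0 < b g g by rewrite lt_neqAle eq_sym g0 form_ge0.
have := form_ge0 ipb (f + (- (b f g) / b g g) *: g).
rewrite form_sqrD.
rewrite (_ : _ + _ = b f f - b f g ^+ 2 / b g g); last by field; rewrite g0.
by rewrite subr_ge0 ler_pdivrMr.
Qed.

Lemma form_normD f g : N (f + g) <= N f + N g.
Proof.
rewrite -ler_sqr ?nnegrE ?addr_ge0 ?form_norm_ge0// sqr_form_norm.
have := form_sqrD f g 1; rewrite scale1r => ->.
have := form_CauchySchwarz f g; rewrite -!sqr_form_norm ler_norml => /andP[_ h].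
nra.
Qed.

Lemma form_normZ a f : N (a *: f) = `|a| * N f.
Proof.
rewrite !form_normE inner_formZl inner_formZr mulrA -expr2.
by rewrite sqrtrM ?sqr_ge0// sqrtr_sqr.
Qed.

Lemma form_norm_sub f g : N f <= N g + N (f - g).
Proof. by rewrite -{1}(subrK g f) addrC form_normD. Qed.

Lemma form_norm_subC f g : N f <= N g + N (g - f).
Proof.
have := form_norm_sub f g.
by rewrite -(opprB g f) -(scaleN1r (g - f)) form_normZ normrN normr1 mul1r.
Qed.

End inner_form.

Section perturbed_form.
Context (R : realType) (V : lmodType R) (dot : V -> V -> R)
  (ipdot : inner_form dot) (S : V -> V).
Hypotheses (symS : forall f g, dot (S f) g = dot f (S g))
  (linS : forall a f g h,
     dot (S (a *: f + g)) h = a * dot (S f) h + dot (S g) h)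
  (normS : forall f, form_norm dot (S f) <= 1 / 2 * form_norm dot f).
Local Notation N := (form_norm dot).

(** The energy: along the semigroup the derivative of b(f, f) is
    2 (<f, Lf> + <f, SLf>), which is what the hypocoercivity assumption
    bounds. *)
Definition perturbed_form f g := dot f g + dot (S f) g.
Local Notation b := perturbed_form.

Lemma perturbed_form_bounds f :
  1 / 2 * N f ^+ 2 <= b f f <= 3 / 2 * N f ^+ 2.
Proof.
have := form_CauchySchwarz ipdot (S f) f.
have := ler_wpM2r (form_norm_ge0 dot f) (normS f).
rewrite ler_norml /perturbed_form -(sqr_form_norm ipdot) => h /andP[h1 h2].
by apply/andP; split; lra.
Qed.

Lemma inner_perturbed_form : inner_form b.
Proof.
split.
- move=> f g; rewrite /b (inner_formC ipdot f g) (symS g).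
  by rewrite (inner_formC ipdot g (S f)).
- by move=> a f g h; rewrite /b linS (form_linear ipdot); ring.
- move=> f; have /andP[+ _] := perturbed_form_bounds f.
  by apply: le_trans; rewrite mulr_ge0// ?sqr_ge0//; lra.
Qed.

Lemma perturbed_form_le f g : b f g <= 3 / 2 * (N f * N g).
Proof.
apply: (le_trans (ler_norm _)).
apply: (le_trans (form_CauchySchwarz inner_perturbed_form f g)).
rewrite -ler_sqr ?nnegrE ?mulr_ge0 ?form_norm_ge0//.
rewrite exprMn !(sqr_form_norm inner_perturbed_form).
have /andP[f1 f2] := perturbed_form_bounds f.
have /andP[g1 g2] := perturbed_form_bounds g.
rewrite (_ : _ ^+ 2 = (3 / 2 * N f ^+ 2) * (3 / 2 * N g ^+ 2)); last by field.
by apply: ler_pM => //; exact: form_ge0 inner_perturbed_form _.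
Qed.

(** One explicit Euler step with generator value v and consistency error e. *)
Lemma energy_step u v e (eps : R) : 0 <= eps ->
  b (u + eps *: (v + e)) (u + eps *: (v + e)) <=
  b u u + eps * (2 * b u v + 3 * (N u * N e) +
                 3 / 2 * eps * (N v + N e) ^+ 2).
Proof.
move=> eps0.
rewrite (form_sqrD inner_perturbed_form) (inner_formDr inner_perturbed_form).
have h1 := perturbed_form_le u e.
have /andP[_ h2] := perturbed_form_bounds (v + e).
have h3 : N (v + e) ^+ 2 <= (N v + N e) ^+ 2.
  by rewrite ler_sqr ?nnegrE ?addr_ge0 ?form_norm_ge0// form_normD.
have h4 : b (v + e) (v + e) <= 3 / 2 * (N v + N e) ^+ 2 by lra.
have h5 := ler_wpM2l eps0 h1.
have h6 := ler_wpM2l (sqr_ge0 eps) h4.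
by lra.
Qed.

(** A discrete substitute for integrating the derivative of the energy: the
    errors of n Euler steps add up to n eps times a quantity that is small with
    eps and eta. *)
Lemma energy_decay (u v e : nat -> V) (eps c M M' eta : R) (n : nat) :
  0 <= eps ->
  (forall k, u k.+1 = u k + eps *: (v k + e k)) ->
  (forall k, (k < n)%N -> b (u k) (v k) <= - c) ->
  (forall k, N (u k) <= M) -> (forall k, N (v k) <= M') ->
  (forall k, N (e k) <= eta) ->
  b (u n) (u n) <= b (u 0) (u 0) +
    n%:R * eps * (- 2 * c + 3 * (M * eta) + 3 / 2 * eps * (M' + eta) ^+ 2).
Proof.
move=> eps0 uS dec uM vM' eeta; elim: n dec => [|n ih] dec.
  by rewrite !mul0r addr0.
apply: le_trans (_ : b (u n) (u n) + eps * (- 2 * c + 3 * (M * eta) +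
    3 / 2 * eps * (M' + eta) ^+ 2) <= _); last first.
  have := ih (fun k kn => dec k (ltnW kn)).
  by rewrite -natr1 mulrDl mul1r mulrDl; lra.
rewrite uS; apply: (le_trans (energy_step _ _ _ eps0)).
have M'0 : 0 <= M' := le_trans (form_norm_ge0 dot _) (vM' 0).
have eta0 : 0 <= eta := le_trans (form_norm_ge0 dot _) (eeta 0).
rewrite lerD2l ler_wpM2l// lerD//; last first.
  apply: ler_wpM2l; first by rewrite mulr_ge0.
  by rewrite ler_sqr ?nnegrE ?addr_ge0 ?form_norm_ge0// lerD.
rewrite lerD//; first by have := dec n (ltnSn n); lra.
by rewrite ler_wpM2l ?ler_pM ?form_norm_ge0//; lra.
Qed.

End perturbed_form.

(** * The inner product of L2 and centring *)

Section L2_space.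
Context (R : realType) (dE : measure_display) (E : measurableType dE)
  (mu : probability E R).
Implicit Types f g h : L2 mu.

Lemma norm2E (f : E -> R) :
  norm2 mu f = ((\int[mu]_x (f x ^+ 2)%:E) `^ 2^-1)%E.
Proof.
rewrite /norm2 unlock /Lnorm; congr (_ `^ _)%E; apply: eq_integral => x _ /=.
by rewrite powR_mulrn// real_normK ?num_real.
Qed.

Lemma Lfun2P (f : E -> R) : f \in Lfun mu 2%:E <->
  measurable_fun setT f /\ (\int[mu]_x (f x ^+ 2)%:E < +oo)%E.
Proof.
split=> [fL|[mf fy]].
  split; first by move: fL; rewrite inE => /andP[/[!inE]].
  exact: (integrable_lty measurableT (Lfun2_integrable_sqr fL)).
rewrite inE; apply/andP; split; rewrite inE//=.
by rewrite /finite_norm -/(norm2 mu f) norm2E poweR_lty.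
Qed.

Definition mkL2 (f : E -> R) (fL : f \in Lfun mu 2%:E) : L2 mu :=
  Lfun_Sub (lee1n 2) fL.

Lemma L2_Lfun f : (f : E -> R) \in Lfun mu 2%:E.
Proof. exact: LfunP. Qed.

Lemma L2_measurable f : measurable_fun setT f.
Proof. by have /Lfun2P[] := L2_Lfun f. Qed.

Lemma L2_integrableM f g : mu.-integrable setT (EFin \o (fun x => f x * g x)).
Proof. by apply/Lfun1_integrable/Lfun2_mul_Lfun1; exact: L2_Lfun. Qed.

End L2_space.

HB.lock Definition dotL2 {R : realType} {dE : measure_display}
  {E : measurableType dE} {mu : probability E R} (f g : L2 mu) : R :=
  dot mu f g.

Section L2_inner_product.
Context (R : realType) (dE : measure_display) (E : measurableType dE)
  (mu : probability E R).
Implicit Types f g h : L2 mu.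
Local Notation dotL2 := (@dotL2 _ _ _ mu).
Local Notation N := (form_norm dotL2).

Lemma EFin_dotL2 f g : (dotL2 f g)%:E = (\int[mu]_x (f x * g x)%:E)%E.
Proof.
rewrite dotL2.unlock /dot /Rintegral fineK//.
exact: (integrable_fin_num measurableT (L2_integrableM f g)).
Qed.

Lemma inner_form_dotL2 : inner_form dotL2.
Proof.
split.
- move=> f g; rewrite dotL2.unlock; apply: eq_Rintegral => x _.
  by rewrite mulrC.
- move=> a f g h; rewrite dotL2.unlock /dot.
  under eq_Rintegral do rewrite /= mulrDl -mulrA.
  rewrite RintegralD//; last 2 first.
    + apply: (integrableZl measurableT a (L2_integrableM f h)).
    + exact: L2_integrableM.
  by rewrite RintegralZl//; exact: L2_integrableM.
- move=> f; rewrite dotL2.unlock; apply: Rintegral_ge0 => x _.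
  by rewrite -expr2 sqr_ge0.
Qed.

Lemma norm2_L2 f : norm2 mu f = (N f)%:E.
Proof.
rewrite norm2E; under eq_integral do rewrite expr2.
rewrite -EFin_dotL2 poweR_EFin powR12_sqrt ?form_normE//.
exact: (form_ge0 inner_form_dotL2).
Qed.

Lemma norm2_ae (f g : E -> R) :
  measurable_fun setT f -> measurable_fun setT g ->
  f = g %[ae mu] -> norm2 mu f = norm2 mu g.
Proof.
move=> mf mg fg; rewrite !norm2E; congr (_ `^ _)%E; apply: ae_eq_integral => //.
- by apply/measurable_EFinP/measurable_funX.
- by apply/measurable_EFinP/measurable_funX.
- by apply: filterS fg => x /(_ I) + _ => ->.
Qed.

Lemma form_norm_ae f g : f = g %[ae mu] -> N f = N g.
Proof.
move=> fg; apply: EFin_inj; rewrite -!norm2_L2.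
by apply: norm2_ae => //; exact: L2_measurable.
Qed.

Lemma dotL2_ae f g h : f = g %[ae mu] -> dotL2 f h = dotL2 g h.
Proof.
move=> fg; apply: EFin_inj; rewrite !EFin_dotL2; apply: ae_eq_integral => //.
- by apply/measurable_EFinP/measurable_funM; exact: L2_measurable.
- by apply/measurable_EFinP/measurable_funM; exact: L2_measurable.
- by apply: filterS fg => x /(_ I) + _ => ->.
Qed.

Definition oneL2 : L2 mu := mkL2 (Lfun_cst mu 1 2).

End L2_inner_product.

HB.lock Definition centerL2 {R : realType} {dE : measure_display}
  {E : measurableType dE} {mu : probability E R} (f : L2 mu) : L2 mu :=
  f - dotL2 f (oneL2 mu) *: oneL2 mu.

Section L2_centering.
Context (R : realType) (dE : measure_display) (E : measurableType dE)
  (mu : probability E R).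
Implicit Types f g h : L2 mu.
Local Notation dotL2 := (@dotL2 _ _ _ mu).
Local Notation centerL2 := (@centerL2 _ _ _ mu).
Local Notation oneL2 := (oneL2 mu).
Local Notation inner_form_dotL2 := (inner_form_dotL2 mu).
Local Notation N := (form_norm dotL2).

Lemma meanE f : mean mu f = dotL2 f oneL2.
Proof.
by rewrite dotL2.unlock; apply: eq_Rintegral => x _ /=; rewrite mulr1.
Qed.

Lemma centerL2E f : centered mu f = centerL2 f.
Proof.
apply/funext => x; rewrite /centered meanE centerL2.unlock.
by rewrite -[RHS]/(f x - dotL2 f oneL2 * 1) mulr1.
Qed.

Lemma dotL2_11 : dotL2 oneL2 oneL2 = 1.
Proof.
apply: EFin_inj; rewrite EFin_dotL2 /=.
under eq_integral do rewrite mulr1.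
by rewrite integral_cst//= mul1e probability_setT.
Qed.

Lemma dotL2_center f : dotL2 (centerL2 f) oneL2 = 0.
Proof.
rewrite centerL2.unlock -scaleN1r (inner_formDl inner_form_dotL2).
rewrite (inner_formZl inner_form_dotL2).
by rewrite (inner_formZl inner_form_dotL2) dotL2_11; ring.
Qed.

Lemma sqr_norm_center f : N f ^+ 2 = dotL2 f oneL2 ^+ 2 + N (centerL2 f) ^+ 2.
Proof.
rewrite !(sqr_form_norm inner_form_dotL2) centerL2.unlock -scaleNr.
rewrite (form_sqrD inner_form_dotL2) dotL2_11; ring.
Qed.

Lemma norm_center_le f : N (centerL2 f) <= N f.
Proof.
rewrite -ler_sqr ?nnegrE ?form_norm_ge0// [leRHS]sqr_norm_center.
by rewrite lerDr sqr_ge0.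
Qed.

Lemma center_id f : dotL2 f oneL2 = 0 -> centerL2 f = f.
Proof. by rewrite centerL2.unlock => ->; rewrite scale0r subr0. Qed.

Lemma norm_center_ae f g : f = g %[ae mu] -> N (centerL2 f) = N (centerL2 g).
Proof.
move=> fg; have mfg := dotL2_ae oneL2 fg.
apply/form_norm_ae; apply: filterS fg => x /(_ I) fgx _.
by rewrite -!centerL2E /centered !meanE mfg fgx.
Qed.

Lemma centerB f g : centerL2 (f - g) = centerL2 f - centerL2 g.
Proof.
rewrite centerL2.unlock -(scaleN1r g) (inner_formDl inner_form_dotL2).
rewrite (inner_formZl inner_form_dotL2) mulN1r scaleN1r scalerBl.
rewrite !opprB -!addrA; congr (_ + _).
by rewrite addrCA [RHS]addrCA; congr (_ + _); exact: addrC.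
Qed.

End L2_centering.

(** * The semigroup of a Markov process on L2 *)

Section semigroup.
Context (R : realType) (dE dO : measure_display) (E : measurableType dE)
  (Omega : measurableType dO) (X : R -> Omega -> E) (P : R.-pker E ~> Omega)
  (mu : probability E R).
Hypotheses (markovX : markov_process X P) (invmu : invariant_measure X P mu).
Local Notation Pt := (transition_semigroup X P).

Lemma measurable_natural_filtration s A :
  natural_filtration X s A -> measurable A.
Proof.
apply: smallest_sub; first exact: sigma_algebra_measurable.
move=> _ [u [B [/andP[u0 _] mB ->]]].
by rewrite -[X in measurable X]setTI; exact: (markov_measurable markovX).
Qed.

Lemma integral_initial x (f : E -> \bar R) : measurable_fun setT f ->
  (\int[P x]_w f (X 0 w) = f x)%E.
Proof.
move=> mf; rewrite (ae_eq_integral (cst (f x)))//.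
- by rewrite integral_cst// prob_kernel mule1.
- exact: measurableT_comp mf (markov_measurable markovX (lexx 0)).
- by apply: filterS (markov_initial markovX x) => w -> _.
Qed.

Lemma ge0_integral_markov x s t A (f : E -> \bar R) : 0 <= s -> 0 <= t ->
  natural_filtration X s A -> measurable_fun setT f -> (forall y, 0 <= f y)%E ->
  (\int[P x]_(w in A) f (X (s + t) w) =
   \int[P x]_(w in A) \int[P (X s w)]_w' f (X t w'))%E.
Proof.
move=> s0 t0 FA mf f0; have mA := measurable_natural_filtration FA.
apply: (ge0_integral_disintegration (k := fun w => P (X s w))) => //.
- by apply: (markov_measurable markovX); rewrite addr_ge0.
- exact: (markov_measurable markovX).
- move=> B mB; apply: measurableT_comp (measurable_kernel P B mB) _.
  exact: (markov_measurable markovX).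
- by move=> B mB; rewrite setIC; exact: (markov_property markovX).
Qed.

Lemma ge0_integral_invariant t (f : E -> \bar R) : 0 <= t ->
  measurable_fun setT f -> (forall y, 0 <= f y)%E ->
  (\int[mu]_x \int[P x]_w f (X t w) = \int[mu]_x f x)%E.
Proof.
move=> t0 mf f0; apply/esym/(ge0_integral_disintegration (phi := id)) => //.
- exact: (markov_measurable markovX).
- by move=> B; exact: measurable_kernel.
- by move=> B mB; rewrite setIT invmu.
Qed.

Lemma measurable_integral_kernel t (f : E -> \bar R) : 0 <= t ->
  measurable_fun setT f -> (forall y, 0 <= f y)%E ->
  measurable_fun setT (fun x => \int[P x]_w f (X t w))%E.
Proof.
move=> t0 mf f0; apply: measurable_fun_integral_kernel => //.
- by move=> B; exact: measurable_kernel.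
- exact: measurableT_comp mf (markov_measurable markovX t0).
Qed.

Lemma measurable_semigroup t (f : E -> R) : 0 <= t ->
  measurable_fun setT f -> measurable_fun setT (Pt t f).
Proof.
move=> t0 mf; apply: measurableT_comp; first exact: fine_measurable.
have mF : measurable_fun setT (EFin \o f) by exact/measurable_EFinP.
rewrite (_ : (fun x => _) = (fun x => \int[P x]_w (EFin \o f)^\+ (X t w) -
  \int[P x]_w (EFin \o f)^\- (X t w)))%E.
  by apply: emeasurable_funB; apply: measurable_integral_kernel => //;
    [exact: measurable_funepos|exact: measurable_funeneg].
apply/funext => x; rewrite integralE.
by congr (_ - _)%E; apply: eq_integral => w _; rewrite ?funeposE ?funenegE.
Qed.

(** Jensen's inequality for the law of X_t under P_x. It holds at every x: when
    the right-hand side is infinite it is trivial. *)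
Lemma sqr_semigroup_le t (f : E -> R) x : 0 <= t -> measurable_fun setT f ->
  ((Pt t f x ^+ 2)%:E <= \int[P x]_w (f (X t w) ^+ 2)%:E)%E.
Proof.
move=> t0 mf; set I := (\int[P x]_w _)%E.
have mfX : measurable_fun setT (fun w => f (X t w)).
  exact: measurableT_comp mf (markov_measurable markovX t0).
have I0 : (0 <= I)%E by apply: integral_ge0 => w _; rewrite lee_fin sqr_ge0.
have := @hoelder _ _ _ (P x) (fun w => f (X t w)) (cst 1) 2 2 mfX
  (measurable_cst _) (ltr0n _ 2) (ltr0n _ 2).
rewrite (_ : 2^-1 + 2^-1 = 1); last by lra.
move=> /(_ erefl); rewrite Lnorm1 Lnorm_cst1 prob_kernel.
rewrite -[1%E]/(1%:E) poweR_EFin powR1 mule1 => h.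
have {}h : (`|\int[P x]_w (f (X t w))%:E| <= I `^ 2^-1)%E.
  apply: le_trans (le_abse_integral _ measurableT _) _.
    exact/measurable_EFinP.
  under eq_integral do rewrite -[f _]mulr1.
  apply: (le_trans h); rewrite unlock /Lnorm le_eqVlt.
  apply/orP; left; apply/eqP.
  congr (_ `^ _)%E; apply: eq_integral => w _ /=.
  by rewrite powR_mulrn// real_normK ?num_real.
rewrite /transition_semigroup /Rintegral.
case: I I0 h => [i| |]//; last by move=> _ _; rewrite leey.
rewrite !lee_fin => i0; rewrite poweR_EFin powR12_sqrt//.
case: (\int[P x]_w _)%E => [j| |]//=; rewrite ?expr0n//= lee_fin => h.
rewrite -[i]sqr_sqrtr// -[j ^+ 2]real_normK ?num_real//.
by rewrite ler_sqr ?nnegrE ?sqrtr_ge0.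
Qed.

Lemma semigroup_Lfun t (t0 : 0 <= t) (f : L2 mu) :
  Pt t f \in Lfun mu 2%:E /\
  (\int[mu]_x (Pt t f x ^+ 2)%:E <= \int[mu]_x (f x ^+ 2)%:E)%E.
Proof.
have mf := L2_measurable f.
have mPf := measurable_semigroup t0 mf.
have mf2 : measurable_fun setT (fun x => (f x ^+ 2)%:E).
  by apply/measurable_EFinP/measurable_funX.
suff h : (\int[mu]_x (Pt t f x ^+ 2)%:E <= \int[mu]_x (f x ^+ 2)%:E)%E.
  split=> //; apply/Lfun2P; split=> //; apply: le_lt_trans h _.
  by have /Lfun2P[] := L2_Lfun f.
rewrite -(ge0_integral_invariant t0 mf2); last first.
  by move=> x; rewrite lee_fin sqr_ge0.
apply: ge0_le_integral => //.
- by move=> x _; rewrite lee_fin sqr_ge0.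
- by apply/measurable_EFinP/measurable_funX.
- by apply: (measurable_integral_kernel t0 mf2) => x; rewrite lee_fin sqr_ge0.
- by move=> x _; exact: sqr_semigroup_le.
Qed.

End semigroup.

(** The nonnegativity of the time is an argument because the variables X_t with
    t < 0 are unconstrained. *)
HB.lock Definition semigroupL2 {R : realType} {dE dO : measure_display}
  {E : measurableType dE} {Omega : measurableType dO} {X : R -> Omega -> E}
  {P : R.-pker E ~> Omega} {mu : probability E R} (markovX : markov_process X P)
  (invmu : invariant_measure X P mu) {t : R} (t0 : 0 <= t) (f : L2 mu) :
  L2 mu :=
  mkL2 (semigroup_Lfun markovX invmu t0 f).1.

Section semigroup_L2.
Context (R : realType) (dE dO : measure_display) (E : measurableType dE)
  (Omega : measurableType dO) (X : R -> Omega -> E) (P : R.-pker E ~> Omega)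
  (mu : probability E R).
Hypotheses (markovX : markov_process X P) (invmu : invariant_measure X P mu).
Local Notation Pt := (transition_semigroup X P).
Local Notation semigroupL2 := (semigroupL2 markovX invmu).

Lemma semigroupL2E t (t0 : 0 <= t) (f : L2 mu) :
  semigroupL2 t0 f = Pt t f :> (E -> R).
Proof. by rewrite semigroupL2.unlock. Qed.

Local Notation dotL2 := (@dotL2 _ _ _ mu).
Local Notation N := (form_norm dotL2).

Lemma semigroup_contraction t (t0 : 0 <= t) (f : L2 mu) :
  N (semigroupL2 t0 f) <= N f.
Proof.
apply: form_norm_le.
rewrite -lee_fin !EFin_dotL2 semigroupL2E.
under eq_integral do rewrite -expr2.
under [leRHS]eq_integral do rewrite -expr2.
exact: (semigroup_Lfun markovX invmu t0 f).2.
Qed.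

Lemma L2_integrable (f : L2 mu) : mu.-integrable setT (EFin \o f).
Proof.
apply/Lfun1_integrable/Lfun_subset12; last exact: L2_Lfun.
exact: fin_num_measure.
Qed.

Lemma ae_integrable_semigroup t (f : L2 mu) : 0 <= t ->
  \forall x \ae mu, (P x).-integrable setT (fun w => (f (X t w))%:E).
Proof.
move=> t0; apply: (ae_integrable_disintegration (nu := mu) (phi := id)) => //.
- exact: (markov_measurable markovX).
- by move=> B; exact: measurable_kernel.
- by move=> B mB; rewrite invmu.
- exact: L2_integrable.
Qed.

Lemma mean_semigroup t (t0 : 0 <= t) (f : L2 mu) :
  dotL2 (semigroupL2 t0 f) (oneL2 mu) = dotL2 f (oneL2 mu).
Proof.
rewrite -!meanE semigroupL2E /mean; congr fine; apply/esym.
apply: (integral_disintegration (nu := mu) (phi := id)) => //.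
- exact: (markov_measurable markovX).
- by move=> B; exact: measurable_kernel.
- by move=> B mB; rewrite invmu.
- exact: L2_integrable.
Qed.

Lemma semigroup_ae_linear t a (f g : L2 mu) : 0 <= t ->
  \forall x \ae mu, Pt t (a *: f + g) x = a * Pt t f x + Pt t g x.
Proof.
move=> t0; apply: filterS2 (ae_integrable_semigroup f t0)
  (ae_integrable_semigroup g t0) => x fi gi.
rewrite /transition_semigroup -RintegralZl// -RintegralD//.
exact: (integrableZl measurableT a fi).
Qed.

(** For almost every x the function f is integrable for the law of X_{s+t}
    under P_x, and the Markov property writes this law as the mixture, over the
    law of X_s, of the laws of X_t. *)
Lemma semigroup_ae_comp s t (t0 : 0 <= t) (f : L2 mu) : 0 <= s ->
  \forall x \ae mu, Pt s (semigroupL2 t0 f) x = Pt (s + t) f x.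
Proof.
move=> s0; rewrite semigroupL2E; have st0 := addr_ge0 s0 t0.
apply: filterS (ae_integrable_semigroup f st0) => x fi.
congr fine; apply/esym.
apply: (integral_disintegration (k := fun w => P (X s w))) => //.
- exact: (markov_measurable markovX).
- exact: (markov_measurable markovX).
- move=> B mB; apply: measurableT_comp (measurable_kernel P B mB) _.
  exact: (markov_measurable markovX).
- move=> B mB.
  have := @markov_property _ _ _ _ _ _ _ markovX x s t setT B s0 t0.
  rewrite setTI; apply=> //.
  have [F0 FC _] := smallest_sigma_algebra setT [set A | exists u B,
    [/\ 0 <= u <= s, measurable B & A = X u @^-1` B]].
  by rewrite -(setD0 setT); exact: FC.
Qed.

End semigroup_L2.

Section semigroup_generator.
Context (R : realType) (dE dO : measure_display) (E : measurableType dE)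
  (Omega : measurableType dO) (X : R -> Omega -> E) (P : R.-pker E ~> Omega)
  (mu : probability E R).
Hypotheses (markovX : markov_process X P) (invmu : invariant_measure X P mu).
Local Notation Pt := (transition_semigroup X P).
Local Notation dotL2 := (@dotL2 _ _ _ mu).
Local Notation N := (form_norm dotL2).
Local Notation T := (semigroupL2 markovX invmu).
Local Notation center := (@centerL2 _ _ _ mu).
Let ip := inner_form_dotL2 mu.

Lemma semigroup0 (f : L2 mu) : T (lexx 0) f = f.
Proof.
apply/LfuneqP => x /=; rewrite semigroupL2E /transition_semigroup /Rintegral.
rewrite (integral_initial markovX x (f := EFin \o f))//.
exact/measurable_EFinP.
Qed.

Lemma eq_semigroupL2 s t (s0 : 0 <= s) (t0 : 0 <= t) (f : L2 mu) :
  s = t -> T s0 f = T t0 f.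
Proof. by move=> st; apply/LfuneqP => x; rewrite !semigroupL2E st. Qed.

Lemma semigroupL2_comp s t (s0 : 0 <= s) (t0 : 0 <= t) (st0 : 0 <= s + t)
  (f : L2 mu) : T s0 (T t0 f) = T st0 f %[ae mu].
Proof.
apply: filterS (semigroup_ae_comp markovX invmu t0 f s0) => x + _.
by rewrite !semigroupL2E.
Qed.

Lemma semigroupL2_linear t (t0 : 0 <= t) a (f g : L2 mu) :
  T t0 (a *: f + g) = a *: T t0 f + T t0 g %[ae mu].
Proof.
apply: filterS (semigroup_ae_linear markovX invmu a f g t0) => x h _.
by rewrite semigroupL2E h -!semigroupL2E.
Qed.

Lemma norm_semigroupB t (t0 : 0 <= t) (f g : L2 mu) :
  N (T t0 f - T t0 g) <= N (f - g).
Proof.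
apply: le_trans (semigroup_contraction markovX invmu t0 (f - g)).
rewrite le_eqVlt; apply/orP; left; apply/eqP/form_norm_ae.
rewrite addrC -scaleN1r (addrC f) -(scaleN1r g).
exact/ae_eq_sym/semigroupL2_linear.
Qed.

Lemma center_semigroup t (t0 : 0 <= t) (f : L2 mu) :
  center (T t0 f) = T t0 (center f) %[ae mu].
Proof.
have -> : center f = (- dotL2 f (oneL2 mu)) *: oneL2 mu + f.
  by rewrite centerL2.unlock scaleNr addrC.
apply: filterS (semigroupL2_linear t0 (- dotL2 f (oneL2 mu)) (oneL2 mu) f).
move=> x /(_ I) -> _; rewrite -centerL2E /centered meanE mean_semigroup.
rewrite -[RHS]/(- dotL2 f (oneL2 mu) * T t0 (oneL2 mu) x + T t0 f x).
rewrite (semigroupL2E markovX invmu t0 (oneL2 mu)).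
by rewrite transition_semigroup_cst1 mulr1 addrC.
Qed.

(** P_t preserves the mean and contracts the norm, hence contracts the
    difference of their squares. *)
Lemma norm_center_semigroup t (t0 : 0 <= t) (f : L2 mu) :
  N (center (T t0 f)) <= N (center f).
Proof.
apply: form_norm_le; rewrite -!(sqr_form_norm ip).
rewrite -(lerD2l (dotL2 f (oneL2 mu) ^+ 2)) -sqr_norm_center.
rewrite -(mean_semigroup markovX invmu t0) -sqr_norm_center.
by rewrite ler_pXn2r ?nnegrE ?form_norm_ge0// semigroup_contraction.
Qed.

(** The error made in replacing Lf, for g = Lf, by the difference quotient. *)
Definition residual (t : R) (t0 : 0 <= t) (f g : L2 mu) : L2 mu :=
  t^-1 *: (T t0 f - f) - g.

Lemma residualE t (t0 : 0 <= t) (f g : L2 mu) x :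
  residual t0 f g x = t^-1 * (Pt t f x - f x) - g x.
Proof. by rewrite -(semigroupL2E markovX invmu t0). Qed.

(** P_s commutes with the difference quotient, so the residual at P_s f is no
    larger than at f: the Euler steps along an orbit have a uniform error. *)
Lemma residual_semigroup s t (s0 : 0 <= s) (t0 : 0 <= t) (f g : L2 mu) :
  residual t0 (T s0 f) (T s0 g) = T s0 (residual t0 f g) %[ae mu].
Proof.
have st0 := addr_ge0 s0 t0; have ts0 := addr_ge0 t0 s0.
near=> x => _; rewrite residualE.
have -> : Pt t (T s0 f) x = Pt (t + s) f x by near: x; exact: semigroup_ae_comp.
have fi : (P x).-integrable setT (fun w => (f (X s w))%:E).
  by near: x; exact: ae_integrable_semigroup.
have gi : (P x).-integrable setT (fun w => (g (X s w))%:E).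
  by near: x; exact: ae_integrable_semigroup.
have Tfi : (P x).-integrable setT (fun w => (T t0 f (X s w))%:E).
  by near: x; exact: ae_integrable_semigroup.
have <- : Pt s (T t0 f) x = Pt (t + s) f x.
  by rewrite addrC; near: x; exact: semigroup_ae_comp.
rewrite !semigroupL2E -(semigroupL2E markovX invmu t0) /transition_semigroup.
under [RHS]eq_Rintegral do rewrite residualE -(semigroupL2E markovX invmu t0).
rewrite RintegralB//; last first.
  exact: (integrableZl measurableT t^-1 (integrableB measurableT Tfi fi)).
rewrite RintegralZl//; last exact: (integrableB measurableT Tfi fi).
by rewrite RintegralB.
Unshelve. all: by end_near. Qed.

Lemma generator_residual (f g : L2 mu) : L2_generator X P mu f g <->
  forall eta, 0 < eta -> exists2 delta, 0 < delta &
    forall t (t0 : 0 <= t), 0 < t < delta -> N (residual t0 f g) <= eta.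
Proof.
have resE t (t0 : 0 <= t) : norm2 mu (fun x => t^-1 * (Pt t f x - f x) - g x) =
    (N (residual t0 f g))%:E.
  by rewrite -norm2_L2; congr (norm2 _ _); apply/funext => x; rewrite residualE.
split=> [/fine_cvgP[_ /cvgrPdist_lt gen] eta eta0|h].
  have [delta /= delta0 hd] := gen eta eta0.
  exists delta => // t t0 /andP[tp td].
  have := hd t; rewrite /= (resE _ t0) /= !sub0r !normrN.
  rewrite !ger0_norm ?form_norm_ge0// => h; apply/ltW/h => //.
apply/fine_cvgP; split.
  near=> t; have t0 : 0 <= t by [].
  by rewrite (resE _ t0).
apply/cvgrPdist_le => eta eta0; have [delta delta0 hd] := h eta eta0.
near=> t; have t0 : 0 <= t by [].
rewrite /= (resE _ t0) /= sub0r normrN ger0_norm ?form_norm_ge0//.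
apply: hd; apply/andP; split=> //.
Unshelve. all: by end_near. Qed.

Lemma generator_semigroup s (s0 : 0 <= s) (f g : L2 mu) :
  L2_generator X P mu f g -> L2_generator X P mu (T s0 f) (T s0 g).
Proof.
move=> /generator_residual h; apply/generator_residual => eta.
move=> /h[delta delta0 hd]; exists delta => // t t0 td.
apply: le_trans (hd t t0 td).
rewrite (form_norm_ae (residual_semigroup s0 t0 f g)).
exact: semigroup_contraction.
Qed.

End semigroup_generator.

(** * Decay of centred functions *)

Section hypocoercivity.
Context (R : realType) (dE dO : measure_display) (E : measurableType dE)
  (Omega : measurableType dO) (X : R -> Omega -> E) (P : R.-pker E ~> Omega)
  (mu : probability E R) (rho : R) (S : L2 mu -> L2 mu).
Hypotheses (markovX : markov_process X P) (invmu : invariant_measure X P mu)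
  (denseL : dense_domain (L2_generator X P mu)) (rho_gt0 : 0 < rho)
  (linS : linear_operator S) (boundedS : bounded_operator S)
  (symS : symmetric_operator S)
  (normS : forall f Lf : L2 mu, L2_generator X P mu f Lf ->
      (norm2 mu (S f) <= (1 / 2)%:E * norm2 mu (centered mu f))%E)
  (hypocoercive : forall f Lf : L2 mu, L2_generator X P mu f Lf ->
      ((dot mu f (Lf + S Lf)%R)%:E <=
        (- rho)%:E * norm2 mu (centered mu f) ^+ 2)%E).
Local Notation dotL2 := (@dotL2 _ _ _ mu).
Local Notation N := (form_norm dotL2).
Local Notation T := (semigroupL2 markovX invmu).
Local Notation center := (@centerL2 _ _ _ mu).
Let ip := inner_form_dotL2 mu.

Lemma operator_dot_linear a (f g h : L2 mu) :
  dotL2 (S (a *: f + g)) h = a * dotL2 (S f) h + dotL2 (S g) h.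
Proof.
by rewrite (dotL2_ae _ (operator_linear linS a f g)) (form_linear ip).
Qed.

Lemma operator_sym (f g : L2 mu) : dotL2 (S f) g = dotL2 f (S g).
Proof. by rewrite dotL2.unlock symS. Qed.

(** The bound is assumed on the domain of the generator; continuity of S and
    density of the domain extend it. *)
Lemma operator_norm (f : L2 mu) : N (S f) <= 1 / 2 * N f.
Proof.
have [C hC] := boundedS.
have bS (g : L2 mu) : N (S g) <= `|C| * N g.
  have := hC g; rewrite !norm2_L2 -EFinM lee_fin => /le_trans; apply.
  by rewrite ler_wpM2r ?form_norm_ge0// ler_norm.
apply/ler_addgt0Pr => e e0.
have C0 : 0 < 1 / 2 + `|C| by rewrite ltr_wpDr.
have [f' [g' [gen]]] := denseL f (divr_gt0 e0 C0).
rewrite norm2_L2 lte_fin => dist.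
have h1 : N (S f') <= 1 / 2 * N f'.
  have := normS gen; rewrite centerL2E !norm2_L2 -EFinM lee_fin.
  move=> /le_trans; apply.
  by rewrite ler_wpM2l// norm_center_le.
have h2 : N (S f - S f') <= `|C| * N (f - f').
  apply: le_trans (bS _); rewrite le_eqVlt.
  apply/orP; left; apply/eqP/form_norm_ae.
  rewrite addrC -scaleN1r (addrC f) -(scaleN1r f').
  exact/ae_eq_sym/(operator_linear linS).
have h3 := form_norm_sub ip (S f) (S f').
have h4 : N f' <= N f + N (f - f').
  exact: form_norm_subC.
have h5 : (1 / 2 + `|C|) * N (f - f') <= e.
  by rewrite mulrC -ler_pdivlMr//; exact: ltW.
move: h1 h2 h3 h4 h5; move: (N _) (N _) (N _) (N _) (N _) (N _) `|C|.
by move=> a b c d i j k; lra.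
Qed.

Let b := perturbed_form dotL2 S.
Let bounds := perturbed_form_bounds ip operator_norm.

Lemma generator_dissipation s (s0 : 0 <= s) (f g : L2 mu) :
  L2_generator X P mu f g ->
  b (T s0 f) (T s0 g) <= - (rho * N (center (T s0 f)) ^+ 2).
Proof.
move=> /(generator_semigroup markovX invmu s0)/hypocoercive.
rewrite centerL2E norm2_L2 -EFin_expe -EFinM lee_fin mulNr.
rewrite /b /perturbed_form operator_sym -(inner_formDr ip).
by rewrite dotL2.unlock.
Qed.

(** The Euler scheme of step eps = t / n along the orbit of f loses at each step
    2 eps rho times the squared norm of the centred P_{k eps} f, which is at least
    that of the centred P_t f since this norm decreases in time. *)
Lemma generator_energy_decay t (t0 : 0 <= t) (f g : L2 mu) : 0 < t ->
  L2_generator X P mu f g ->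
  b (T t0 f) (T t0 f) + 2 * rho * t * N (center (T t0 f)) ^+ 2 <= b f f.
Proof.
move=> tp gen; apply/ler_addgt0Pr => tau tau0.
set D := rho * N (center (T t0 f)) ^+ 2.
set M := N f; set M' := N g.
have M0 : 0 <= M := form_norm_ge0 _ _; have M'0 : 0 <= M' := form_norm_ge0 _ _.
(* eta and delta' make the error of the scheme at most tau / t per unit time *)
pose eta := Num.min 1 (tau / t / (6 * (M + 1))).
have eta0 : 0 < eta by rewrite lt_min ltr01 !divr_gt0// mulr_gt0//; lra.
have [delta delta0 hdelta] :=
  (generator_residual markovX invmu f g).1 gen eta eta0.
pose delta' := Num.min delta (tau / t / (3 * (M' + 1) ^+ 2)).
have delta'0 : 0 < delta'.
  by rewrite lt_min delta0 !divr_gt0// mulr_gt0// exprn_gt0//; lra.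
pose n := (Num.truncn (t / delta')).+1.
have ntd : t / delta' < n%:R by rewrite /n truncnS_gt// divr_ge0// ltW.
have n0 : 0 < n%:R :> R by rewrite ltr0n.
pose eps := t / n%:R.
have eps0 : 0 < eps by rewrite divr_gt0.
have epsd : eps < delta' by rewrite /eps ltr_pdivrMr// mulrC -ltr_pdivrMr.
have neps : n%:R * eps = t by rewrite /eps mulrC divfK// gt_eqF.
have k0 (k : nat) : 0 <= k%:R * eps by rewrite mulr_ge0// ltW.
pose u k := T (k0 k) f; pose v k := T (k0 k) g.
pose e k := eps^-1 *: (u k.+1 - u k) - v k.
have eE k : N (e k) <= eta.
  have := residual_semigroup markovX invmu (k0 k) (ltW eps0) f g.
  move/form_norm_ae => h.
  have uS : T (ltW eps0) (u k) = u k.+1 %[ae mu].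
    have ek0 : 0 <= eps + k%:R * eps by rewrite addr_ge0// ltW.
    rewrite /u (eq_semigroupL2 _ _ (k0 k.+1) ek0); last by rewrite -natr1; ring.
    exact: semigroupL2_comp.
  rewrite (_ : N (e k) = N (residual markovX invmu (ltW eps0) (u k) (v k))).
    rewrite h; apply: le_trans (semigroup_contraction markovX invmu (k0 k) _) _.
    by apply: hdelta; rewrite eps0/= (lt_le_trans epsd)// ge_min lexx.
  apply: form_norm_ae; apply: filterS uS => x /(_ I) + _.
  rewrite /e /residual => uS.
  by rewrite -[LHS]/(eps^-1 * (u k.+1 x - u k x) - v k x) -uS.
have := energy_decay ip operator_sym operator_dot_linear operator_norm
  (u := u) (v := v) (e := e) (c := D) (M := M) (M' := M') (eta := eta)
  (n := n) (ltW eps0).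
rewrite (_ : u n = T t0 f); last exact: eq_semigroupL2.
rewrite (_ : u 0%N = f); last first.
  rewrite -[RHS](semigroup0 markovX invmu).
  by apply: eq_semigroupL2; rewrite mul0r.
rewrite neps => h.
have {}h : b (T t0 f) (T t0 f) <= b f f +
    t * (- 2 * D + 3 * (M * eta) + 3 / 2 * eps * (M' + eta) ^+ 2).
  apply: h => [k|k kn|k|k|k]; last exact: eE.
  - by rewrite /e [v k + _]addrC subrK scalerA mulfV ?gt_eqF// scale1r subrKC.
  - apply: (le_trans (generator_dissipation (k0 k) gen)).
    rewrite lerN2 /D; apply: ler_wpM2l; first exact: ltW.
    rewrite ler_pXn2r ?nnegrE ?form_norm_ge0//.
    have nk0 : 0 <= (n - k)%:R * eps by rewrite mulr_ge0// ltW.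
    have nkk0 : 0 <= (n - k)%:R * eps + k%:R * eps by rewrite addr_ge0.
    rewrite (eq_semigroupL2 _ _ t0 nkk0); last first.
      by rewrite -mulrDl -natrD subnK ?neps// ltnW.
    apply: le_trans (norm_center_semigroup markovX invmu nk0 _).
    rewrite le_eqVlt; apply/orP; left; apply/eqP/norm_center_ae.
    exact/ae_eq_sym/semigroupL2_comp.
  - exact: semigroup_contraction.
  - exact: semigroup_contraction.
have h1 : 3 * (M * eta) <= tau / t / 2.
  have : eta <= tau / t / (6 * (M + 1)) by rewrite ge_min lexx orbT.
  rewrite ler_pdivlMr; last by lra.
  by move: (tau / t) M0 => q M0; lra.
have h2 : 3 / 2 * eps * (M' + eta) ^+ 2 <= tau / t / 2.
  have : eps <= tau / t / (3 * (M' + 1) ^+ 2).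
    by apply/ltW/(lt_le_trans epsd); rewrite ge_min lexx orbT.
  rewrite ler_pdivlMr; last by rewrite mulr_gt0// exprn_gt0//; lra.
  have : (M' + eta) ^+ 2 <= (M' + 1) ^+ 2.
    rewrite ler_pXn2r ?nnegrE ?lerD2l//; [|lra|lra].
    by rewrite ge_min lexx.
  move=> /(ler_wpM2l (ltW eps0)).
  by move: (tau / t) ((M' + eta) ^+ 2) ((M' + 1) ^+ 2) => q x y; lra.
have : t * (3 * (M * eta) + 3 / 2 * eps * (M' + eta) ^+ 2) <= t * (tau / t).
  by rewrite ler_wpM2l//; lra.
rewrite (mulrCA t) mulfV ?gt_eqF// mulr1 /D in h *.
move: h; move: (b _ _) (b _ _) (N _ ^+ 2) (3 * (M * eta)) (3 / 2 * _ * _).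
by move=> x y z a c; lra.
Qed.

(** For centred f the energy decay compares (1/2 + 2 rho t) |P_t f|^2, where
    2 rho t = 6, with 3/2 |f|^2, and 3/2 is less than a quarter of 13/2. It is
    available on the domain of the generator, whose elements approximating f need
    not be centred. *)
Lemma hypocoercive_contraction t (t0 : 0 <= t) (f : L2 mu) : t = 3 / rho ->
  N (center (T t0 f)) <= 1 / 2 * N (center f).
Proof.
move=> tE; have tp : 0 < t by rewrite tE divr_gt0.
suff main (w : L2 mu) : dotL2 w (oneL2 mu) = 0 -> N (T t0 w) <= 1 / 2 * N w.
  have := main (center f) (dotL2_center f); apply: le_trans.
  rewrite le_eqVlt; apply/orP; left; apply/eqP/form_norm_ae.
  exact: center_semigroup.
move=> w0; apply/ler_addgt0Pr => e e0.
have e3 : 0 < e / 2 by rewrite divr_gt0.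
have [f' [g' [gen]]] := denseL w e3.
rewrite norm2_L2 lte_fin => dist.
have := generator_energy_decay t0 tp gen.
rewrite (_ : 2 * rho * t = 6); last by rewrite tE; field; rewrite gt_eqF.
have /andP[+ _] := bounds (T t0 f'); have /andP[_ +] := bounds f'.
rewrite -/b; move=> h1 h2 h3.
have cT : N (center (T t0 w)) = N (T t0 w).
  by rewrite center_id// mean_semigroup.
have h4 := form_norm_sub ip (T t0 w) (T t0 f').
have h5 := norm_semigroupB markovX invmu t0 w f'.
have h6 : N (T t0 w) <= N (center (T t0 f')) + N (T t0 w - T t0 f').
  rewrite -cT; apply: (le_trans (form_norm_sub ip _ (center (T t0 f')))).
  by rewrite lerD2l -centerB norm_center_le.
have h7 : N f' <= N w + N (w - f').
  exact: form_norm_subC.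
have n1 := form_norm_ge0 dotL2 (T t0 f').
have n2 := form_norm_ge0 dotL2 (center (T t0 f')).
have n3 := form_norm_ge0 dotL2 f'.
have n4 := form_norm_ge0 dotL2 w.
move: h1 h2 h3 h4 h5 h6 h7 dist n1 n2 n3 n4.
move: (b _ _) (b _ _) (N (T t0 w)) (N (T t0 f')) (N (center _)) (N f') (N w)
  (N (w - _)) (N (T t0 w - _)).
move=> b1 b2 x x' y' z' z d d' h1 h2 h3 h4 h5 h6 h7 dist n1 n2 n3 n4.
have [xd|xd] := leP x d; first by lra.
have : (2 * (x - d)) ^+ 2 <= z' ^+ 2.
  have : (x - d) ^+ 2 <= x' ^+ 2 by rewrite ler_pXn2r ?nnegrE//; lra.
  have : (x - d) ^+ 2 <= y' ^+ 2 by rewrite ler_pXn2r ?nnegrE//; lra.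
  by have := sqr_ge0 z'; rewrite exprMn; lra.
rewrite ler_pXn2r ?nnegrE//; lra.
Qed.

End hypocoercivity.

(** * Restriction to a set *)

Section indicator_Lfun.
Context (R : realType) (dE : measure_display) (E : measurableType dE)
  (mu : probability E R).

Lemma indicM_Lfun (A : set E) (mA : measurable A) (f : L2 mu) :
  (fun x => \1_A x * f x) \in Lfun mu 2%:E.
Proof.
have mAf : measurable_fun setT (fun x => \1_A x * f x).
  by apply: measurable_funM; [exact: measurable_indic|exact: L2_measurable].
have mf2 : measurable_fun setT (fun x => (f x ^+ 2)%:E).
  by apply/measurable_EFinP/measurable_funX.
apply/Lfun2P; split=> //.
have /Lfun2P[_] := L2_Lfun f; apply: le_lt_trans; apply: ge0_le_integral => //.
- by move=> x _; rewrite lee_fin sqr_ge0.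
- by apply/measurable_EFinP/measurable_funX.
- by move=> x _; rewrite lee_fin exprMn ler_piMl ?sqr_ge0.
Qed.

End indicator_Lfun.

HB.lock Definition restrictL2 {R : realType} {dE : measure_display}
  {E : measurableType dE} {mu : probability E R} {A : set E}
  (mA : measurable A) (f : L2 mu) : L2 mu := mkL2 (indicM_Lfun mA f).

Section restriction.
Context (R : realType) (dE : measure_display) (E : measurableType dE)
  (mu : probability E R) (A : set E) (mA : measurable A).
Implicit Types f g : L2 mu.
Local Notation dotL2 := (@dotL2 _ _ _ mu).
Local Notation N := (form_norm dotL2).
Let ip := inner_form_dotL2 mu.

Lemma restrictL2E f x : restrictL2 mA f x = \1_A x * f x.
Proof. by rewrite restrictL2.unlock. Qed.

Lemma restrictL2_linear a f g :
  restrictL2 mA (a *: f + g) = a *: restrictL2 mA f + restrictL2 mA g.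
Proof.
apply/LfuneqP => x; rewrite restrictL2E.
rewrite -[RHS]/(a * restrictL2 mA f x + restrictL2 mA g x) !restrictL2E.
rewrite (_ : (a *: f + g : L2 mu) x = a * f x + g x)//; ring.
Qed.

Lemma sqr_norm_restrict f :
  (N (restrictL2 mA f) ^+ 2)%:E = (\int[mu]_x (\1_A x * f x ^+ 2)%:E)%E.
Proof.
rewrite (sqr_form_norm ip) EFin_dotL2; apply: eq_integral => x _.
rewrite restrictL2E indicE; case: (x \in A); rewrite ?mul1r ?mul0r//.
Qed.

Lemma norm_restrict_le f : N (restrictL2 mA f) <= N f.
Proof.
apply: form_norm_le; rewrite -lee_fin !EFin_dotL2.
apply: ge0_le_integral => //.
- by move=> x _; rewrite lee_fin -expr2 sqr_ge0.
- by apply/measurable_EFinP/measurable_funM.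
- by apply/measurable_EFinP/measurable_funM.
- move=> x _; rewrite lee_fin restrictL2E indicE.
  by case: (x \in A); rewrite ?mul1r// !mul0r -expr2 sqr_ge0.
Qed.

Lemma sqr_norm_restrict1 : N (restrictL2 mA (oneL2 mu)) ^+ 2 = fine (mu A).
Proof.
apply: EFin_inj; rewrite sqr_norm_restrict fineK ?fin_num_measure//.
have := integral_indic mu measurableT mA; rewrite setIT => <-.
by apply: eq_integral => x _; rewrite expr1n mulr1.
Qed.

(** Write the constant m on A as f minus its centred part. *)
Lemma mean_le_restrict f : `|dotL2 f (oneL2 mu)| * Num.sqrt (fine (mu A)) <=
  N (restrictL2 mA f) + N (restrictL2 mA (centerL2 f)).
Proof.
set m := dotL2 f _.
have -> : `|m| * Num.sqrt (fine (mu A)) = N (m *: restrictL2 mA (oneL2 mu)).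
  rewrite (form_normZ ip); congr (_ * _).
  by rewrite -sqr_norm_restrict1 sqrtr_sqr ger0_norm ?form_norm_ge0.
have -> : m *: restrictL2 mA (oneL2 mu) =
    restrictL2 mA f + (-1) *: restrictL2 mA (centerL2 f).
  rewrite addrC -restrictL2_linear centerL2.unlock -/m scaleN1r opprB subrK.
  rewrite -[LHS]addr0 -[in RHS](addr0 (m *: _)) restrictL2_linear.
  congr (_ + _); apply/LfuneqP => x; rewrite restrictL2E; exact/esym/mulr0.
apply: (le_trans (form_normD ip _ _)).
by rewrite (form_normZ ip) normrN normr1 mul1r.
Qed.

End restriction.

Lemma sqr_norm_restrictC (R : realType) (dE : measure_display)
    (E : measurableType dE) (mu : probability E R) (A : set E)
    (mA : measurable A) (mAC : measurable (~` A)) (f : L2 mu) :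
  form_norm dotL2 (restrictL2 mAC f) ^+ 2 =
  form_norm dotL2 f ^+ 2 - form_norm dotL2 (restrictL2 mA f) ^+ 2.
Proof.
apply/eqP; rewrite eq_sym subr_eq; apply/eqP/EFin_inj.
rewrite (EFinD (_ ^+ 2)) !sqr_norm_restrict.
rewrite (sqr_form_norm (inner_form_dotL2 mu)) EFin_dotL2.
have m1 B : measurable B ->
    measurable_fun setT (fun x => (\1_B x * f x ^+ 2)%:E).
  move=> mB; apply/measurable_EFinP/measurable_funM.
    exact: measurable_indic.
  exact/measurable_funX/L2_measurable.
have p B x : setT x -> (0 <= (\1_B x * f x ^+ 2)%:E)%E.
  by move=> _; rewrite lee_fin mulr_ge0 ?sqr_ge0.
rewrite -ge0_integralD//; [|exact: p|exact: m1|exact: p|exact: m1].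
apply: eq_integral => x _; rewrite -EFinD -mulrDl expr2 !indicE in_setC.
by case: (x \in A); rewrite /= ?addr0 ?add0r mul1r.
Qed.

(** Here m and a are the mean and the centred norm of f, al is the centred norm
    of g = P_h f, be the norm of g on U and q the squared norm of g outside U. If
    g loses little in U then be is small, so that m^2 r is controlled by al^2,
    which is at most a^2 / 4: the factor gained comes from a^2. Otherwise be^2
    itself pays for it. *)
Lemma killed_step_bound (R : realFieldType) (r m a al be q : R) :
  0 <= r <= 1 -> 0 <= al -> 0 <= be -> 2 * al <= a ->
  m ^+ 2 * r <= (be + al) ^+ 2 -> q = m ^+ 2 + al ^+ 2 - be ^+ 2 ->
  (1 + r / 8) ^+ 2 * q <= m ^+ 2 + a ^+ 2.
Proof.
move=> /andP[r0 r1] al0 be0 ala mr ->.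
have ha : 4 * al ^+ 2 <= a ^+ 2.
  have : (2 * al) ^+ 2 <= a ^+ 2 by rewrite ler_pXn2r ?nnegrE//; lra.
  by rewrite exprMn; lra.
have rr : r ^+ 2 <= r by rewrite expr2 ler_piMl.
have hm := sqr_ge0 m; have hal := sqr_ge0 al; have hbe := sqr_ge0 be.
have h1 : (1 + r / 8) ^+ 2 * (m ^+ 2 + al ^+ 2 - be ^+ 2) <=
   m ^+ 2 + al ^+ 2 - be ^+ 2 + 17 / 64 * (m ^+ 2 * r + al ^+ 2 * r).
  have -> : (1 + r / 8) ^+ 2 = 1 + (r / 4 + r ^+ 2 / 64) by field.
  have : (r / 4 + r ^+ 2 / 64) * (m ^+ 2 + al ^+ 2 - be ^+ 2) <=
         (r / 4 + r ^+ 2 / 64) * (m ^+ 2 + al ^+ 2).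
    by rewrite ler_wpM2l ?gerBl//; have := sqr_ge0 r; lra.
  have : (r / 4 + r ^+ 2 / 64) * (m ^+ 2 + al ^+ 2) <=
         (17 / 64 * r) * (m ^+ 2 + al ^+ 2).
    by rewrite ler_wpM2r ?addr_ge0//; lra.
  by move=> h1 h2; rewrite [leLHS]mulrDl mul1r; lra.
have h2 : al ^+ 2 * r <= al ^+ 2 by rewrite ler_piMr.
have h3 : 2 * (al * be) <= al ^+ 2 + be ^+ 2.
  by have := sqr_ge0 (al - be); rewrite sqrrB; lra.
have h4 : (be + al) ^+ 2 = be ^+ 2 + 2 * (al * be) + al ^+ 2 by ring.
by move: h1 h2 h3 h4 mr ha hal hbe; lra.
Qed.

(** * The process killed in U, observed on a time grid *)

Section killed_process.
Context (R : realType) (dE dO : measure_display) (E : measurableType dE)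
  (Omega : measurableType dO) (X : R -> Omega -> E) (P : R.-pker E ~> Omega)
  (markovX : markov_process X P) (U : set E) (mU : measurable U)
  (h : R) (h0 : 0 <= h).
Local Notation Pt := (transition_semigroup X P).

Definition survival (k : nat) : set Omega :=
  [set w | forall j, (j <= k)%N -> ~ U (X (j%:R * h) w)].

Definition killed_step (f : E -> R) (x : E) : R := \1_(~` U) x * Pt h f x.

Lemma survival0 : survival 0 = X (0%:R * h) @^-1` (~` U).
Proof.
apply/seteqP; split=> w /=; first exact.
by move=> nU j; rewrite leqn0 => /eqP ->.
Qed.

Lemma survivalS k :
  survival k.+1 = survival k `&` X (k.+1%:R * h) @^-1` (~` U).
Proof.
apply/seteqP; split=> w /=.
  by move=> s; split=> [j jk|]; apply: s => //; exact: ltnW.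
by move=> [s nU] j; rewrite leq_eqVlt => /predU1P[->//|]; exact: s.
Qed.

Lemma survival_filtration k s : k%:R * h <= s ->
  natural_filtration X s (survival k).
Proof.
have gen (j : nat) t : j%:R * h <= t ->
    natural_filtration X t (X (j%:R * h) @^-1` (~` U)).
  move=> jt; apply: sub_sigma_algebra; exists (j%:R * h), (~` U).
  by split; [rewrite jt mulr_ge0|exact: measurableC|].
elim: k => [|k ih] ks; first by rewrite survival0; exact: gen.
rewrite survivalS; apply: (@measurableI _ (g_sigma_algebraType
  [set A | exists u B, [/\ 0 <= u <= s, measurable B & A = X u @^-1` B]])).
  by apply: ih; apply: le_trans ks; rewrite ler_wpM2r// ler_nat.
exact: gen.
Qed.

Lemma measurable_survival k : measurable (survival k).
Proof.
exact: (measurable_natural_filtration markovX (survival_filtration (lexx _))).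
Qed.

Lemma EFin_semigroup t (g : E -> R) x : 0 <= t -> measurable_fun setT g ->
  (forall y, 0 <= g y <= 1) ->
  (Pt t g x)%:E = (\int[P x]_w (g (X t w))%:E)%E /\ 0 <= Pt t g x <= 1.
Proof.
move=> t0 mg g01.
have mgX : measurable_fun setT (EFin \o (fun w => g (X t w))).
  apply/measurable_EFinP.
  exact: measurableT_comp mg (markov_measurable markovX t0).
have I0 : (0 <= \int[P x]_w (g (X t w))%:E)%E.
  by apply: integral_ge0 => w _; rewrite lee_fin; case/andP: (g01 (X t w)).
have I1 : (\int[P x]_w (g (X t w))%:E <= 1)%E.
  rewrite -[leRHS](@prob_kernel _ _ _ _ _ P x) -[leRHS]mul1e -integral_cst//.
  apply: ge0_le_integral => //.
  - by move=> w _; rewrite lee_fin; case/andP: (g01 (X t w)).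
  - by move=> w _; rewrite lee_fin; case/andP: (g01 (X t w)).
have fin : (\int[P x]_w (g (X t w))%:E)%E \is a fin_num.
  by rewrite ge0_fin_numE// (le_lt_trans I1)// ltry.
rewrite /transition_semigroup /Rintegral fineK//; split=> //.
by rewrite -!lee_fin fineK// I0 I1.
Qed.

Lemma integral_indic_preimage x A t (f : E -> R) : measurable A -> 0 <= t ->
  (\int[P x]_(w in A `&` X t @^-1` (~` U)) (f (X t w))%:E =
   \int[P x]_(w in A) (\1_(~` U) (X t w) * f (X t w))%:E)%E.
Proof.
move=> mA t0; rewrite integral_mkcondr; apply: eq_integral => w _.
rewrite patchE /= indicE in_setC.
rewrite (_ : (w \in _) = (X t w \notin U)).
  by case: (X t w \in U); rewrite /= ?mul0r ?mul1r.
by rewrite -in_setC; apply/idP/idP => /set_mem/mem_set.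
Qed.

(** By induction on k: the Markov property at time k h replaces the function v
    killed in U, at time (k+1) h, by its image under P_h. *)
Lemma integral_survival k x (v : E -> R) : measurable_fun setT v ->
  (forall y, 0 <= v y <= 1) ->
  (\int[P x]_(w in survival k) (v (X (k%:R * h) w))%:E =
   (iter k killed_step (fun y => \1_(~` U) y * v y) x)%:E)%E.
Proof.
have kill01 (g : E -> R) : measurable_fun setT g -> (forall y, 0 <= g y <= 1) ->
    measurable_fun setT (fun y => \1_(~` U) y * g y) /\
    (forall y, 0 <= \1_(~` U) y * g y <= 1).
  move=> mg g01; split.
    by apply: measurable_funM => //; exact/measurable_indic/measurableC.
  move=> y; rewrite indicE; case: (y \in _); rewrite ?mul1r ?mul0r ?lexx//=.
elim: k v => [|k ih] v mv v01; have [mg g01] := kill01 v mv v01.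
  rewrite survival0 -(setTI (_ @^-1` _)) integral_indic_preimage ?mul0r//.
  rewrite (integral_initial markovX x
    (f := fun y => (\1_(~` U) y * v y)%:E))//.
  exact/measurable_EFinP.
have k0 : 0 <= k%:R * h by rewrite mulr_ge0.
have mk := measurable_survival k.
rewrite survivalS integral_indic_preimage ?mulr_ge0//.
rewrite (_ : k.+1%:R * h = k%:R * h + h); last by rewrite -natr1; ring.
rewrite (ge0_integral_markov markovX
  (f := fun y => (\1_(~` U) y * v y)%:E) x k0 h0)//; last 3 first.
- exact: survival_filtration.
- exact/measurable_EFinP.
- by move=> y; rewrite lee_fin; case/andP: (g01 y).
under eq_integral do rewrite -(EFin_semigroup _ h0 mg g01).1.
rewrite ih; first by rewrite iterSr.
- exact: measurable_semigroup.
- by move=> y; exact: (EFin_semigroup _ h0 mg g01).2.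
Qed.

Lemma probability_survival k x :
  P x (survival k) = (iter k killed_step \1_(~` U) x)%:E.
Proof.
have mk := measurable_survival k.
transitivity (\int[P x]_(w in survival k) (cst 1%E w))%E.
  by rewrite integral_cst// mul1e.
rewrite (integral_survival k x (v := cst 1) (measurable_cst _)); last first.
  by move=> y; rewrite ler01 lexx.
by congr (iter _ _ _ _)%:E; apply/funext => y; rewrite mulr1.
Qed.

End killed_process.

(** Change of variables and the Cauchy-Schwarz inequality in L2(mu). *)
Lemma integral_le_Radon_Nikodym (R : realType) (dE : measure_display)
    (E : measurableType dE) (mu nu : probability E R) (f : L2 mu) :
  nu `<< mu -> (forall x, 0 <= f x <= 1) ->
  (\int[nu]_x (f x)%:E <=
   'N[mu]_2%:E['d (charge_of_finite_measure nu) '/d mu] *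
   (form_norm dotL2 f)%:E)%E.
Proof.
move=> numu f01.
set g := 'd (charge_of_finite_measure nu) '/d mu.
have mg : measurable_fun setT g.
  by apply: measurable_int; exact: Radon_Nikodym_integrable.
have gE x : g x = (fine (g x))%:E by rewrite fineK// Radon_Nikodym_fin_num.
have mg' : measurable_fun setT (fine \o g).
  by apply: measurableT_comp => //; exact: fine_measurable.
have fnu : nu.-integrable setT (EFin \o f).
  apply: (@le_integrable _ _ _ nu _ measurableT _ (cst 1%E)) => //; last first.
    exact: finite_measure_integrable_cst.
  - move=> x _; case/andP: (f01 x) => ? ?.
    by rewrite /= normr1 ger0_norm// lee_fin.
  - exact/measurable_EFinP.
rewrite -(Radon_Nikodym_change_of_variables numu measurableT fnu).
rewrite -norm2_L2 muleC.
rewrite (_ : 'N[mu]_2%:E[g] = 'N[mu]_2%:E[EFin \o (fine \o g)])%E; last first.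
  by apply: eq_Lnorm => x /=; rewrite -gE.
apply: le_trans (@hoelder _ _ _ mu f (fine \o g) 2 2 _ _ _ _ _) => //;
  last by lra.
rewrite Lnorm1; apply: le_trans (lee_abs _) _.
apply: le_trans (le_abse_integral _ measurableT _) _.
  by apply: emeasurable_funM => //; exact/measurable_EFinP.
rewrite le_eqVlt; apply/orP; left; apply/eqP/eq_integral => x _.
by rewrite /= -/g gE.
Qed.

Section survival_decay.
Context (R : realType) (dE dO : measure_display) (E : measurableType dE)
  (Omega : measurableType dO) (X : R -> Omega -> E) (P : R.-pker E ~> Omega)
  (mu : probability E R) (markovX : markov_process X P)
  (invmu : invariant_measure X P mu) (U : set E) (mU : measurable U)
  (h : R) (h0 : 0 <= h).
Local Notation dotL2 := (@dotL2 _ _ _ mu).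
Local Notation N := (form_norm dotL2).
Local Notation T := (semigroupL2 markovX invmu h0).
Local Notation center := (@centerL2 _ _ _ mu).
Let mUC : measurable (~` U) := measurableC mU.
Let ip := inner_form_dotL2 mu.
Hypothesis contraction : forall f : L2 mu,
  N (center (T f)) <= 1 / 2 * N (center f).

Definition killedL2 (f : L2 mu) : L2 mu := restrictL2 mUC (T f).

(** P_h keeps the mean of f and halves its centred part; the squared norm of
    P_h f outside U is then compared with that of f by killed_step_bound. *)
Lemma killedL2_contraction f :
  (1 + fine (mu U) / 8) * N (killedL2 f) <= N f.
Proof.
set r := fine (mu U).
have r0 : 0 <= r by rewrite fine_ge0.
have r1 : r <= 1 by rewrite -lee_fin fineK ?fin_num_measure// probability_le1.
have d0 : 0 <= 1 + r / 8 by rewrite addr_ge0// divr_ge0.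
rewrite -(@ler_pXn2r _ 2)// ?nnegrE ?mulr_ge0 ?form_norm_ge0//.
rewrite exprMn (sqr_norm_center f).
apply: (@killed_step_bound _ r _ _ (N (center (T f)))
  (N (restrictL2 mU (T f)))).
- by rewrite r0 r1.
- exact: form_norm_ge0.
- exact: form_norm_ge0.
- by have := contraction f; move: (N _) (N _) => x y; lra.
- rewrite -(mean_semigroup markovX invmu h0).
  rewrite -[X in _ * X](sqr_sqrtr r0) -exprMn -real_normK ?num_real//.
  rewrite normrM [X in _ * X]ger0_norm ?sqrtr_ge0//.
  rewrite ler_pXn2r ?nnegrE ?mulr_ge0 ?addr_ge0 ?form_norm_ge0 ?sqrtr_ge0//.
  apply: (le_trans (mean_le_restrict mU (T f))).
  by rewrite lerD2l norm_restrict_le.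
- rewrite /killedL2 (sqr_norm_restrictC mU) (sqr_norm_center (T f)).
  by rewrite mean_semigroup.
Qed.

(** The exponent is k.+1 rather than k because P_h 1 = 1, so that the indicator
    of the complement of U is itself the image of 1 under the killed step; this
    yields one more factor of decay. *)
Definition survivalL2 k : L2 mu := iter k.+1 killedL2 (oneL2 mu).

Lemma survivalL2E k x : P x (survival X U h k) = (survivalL2 k x)%:E.
Proof.
rewrite (probability_survival markovX mU h0); congr EFin.
have kE (f : L2 mu) : killedL2 f = killed_step X P U h f :> (E -> R).
  by apply/funext => y; rewrite restrictL2E semigroupL2E.
rewrite /survivalL2; congr (_ x); rewrite iterSr.
elim: k => [|k ih]; last by rewrite !iterS kE ih.
apply/funext => y; rewrite [LHS]/= [iter 0 _ _]/= kE /killed_step.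
by rewrite transition_semigroup_cst1 mulr1.
Qed.

Lemma norm_survivalL2 k : N (survivalL2 k) <= (1 + fine (mu U) / 8)^-1 ^+ k.+1.
Proof.
set q := (_)^-1.
have d0 : 0 < 1 + fine (mu U) / 8 by rewrite ltr_pwDl// divr_ge0 ?fine_ge0.
have N1 : N (oneL2 mu) = 1 by rewrite form_normE dotL2_11 sqrtr1.
have step f : N (killedL2 f) <= q * N f.
  by rewrite -ler_pdivrMl ?invr_gt0// invrK killedL2_contraction.
rewrite /survivalL2; elim: k.+1 => [|j ih]; first by rewrite N1.
rewrite iterS exprS; apply: (le_trans (step _)).
by rewrite ler_wpM2l// invr_ge0 ltW.
Qed.

Lemma started_from_survival (nu : probability E R) k : nu `<< mu ->
  (started_from nu P (survival X U h k) <=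
   'N[mu]_2%:E['d (charge_of_finite_measure nu) '/d mu] *
   ((1 + fine (mu U) / 8)^-1 ^+ k.+1)%:E)%E.
Proof.
move=> numu; rewrite /started_from.
under eq_integral do rewrite survivalL2E.
apply: le_trans (integral_le_Radon_Nikodym numu _) _.
  move=> x; rewrite -!lee_fin -survivalL2E measure_ge0/=.
  rewrite -[leRHS](@prob_kernel _ _ _ _ _ P x).
  apply: le_measure; rewrite ?inE//.
  exact: (measurable_survival markovX mU h0).
by rewrite lee_wpmul2l ?Lnorm_ge0// lee_fin norm_survivalL2.
Qed.

End survival_decay.

(** * Exponential moments of the hitting time *)

Section hitting_time_bound.
Context (R : realType) (dE dO : measure_display) (E : measurableType dE)
  (Omega : measurableType dO) (X : R -> Omega -> E) (U : set E)
  (h theta : R) (h0 : 0 < h) (theta0 : 0 < theta).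
Let x := expR (theta * h).
(* the increments of the powers of x: 1 + c 0 + ... + c (n-1) = x ^+ n *)
Let c k := (x - 1) * x ^+ k.

Let x1 : 1 < x. Proof. by rewrite expR_gt1 mulr_gt0. Qed.

Let c0 k : 0 <= c k.
Proof. by rewrite mulr_ge0 ?subr_ge0 ?exprn_ge0// ltW// (lt_trans ltr01). Qed.

Let sum_c n : \sum_(0 <= k < n) c k = x ^+ n - 1.
Proof. by rewrite subrX1 mulr_sumr big_mkord. Qed.

(** If n h is the first grid time at which the process is in U, the right-hand
    side telescopes to exp(theta n h), and T_U <= n h; if there is no such time
    it is infinite. *)
Lemma expeR_hitting_time_le w :
  (expeR (theta%:E * hitting_time X U w) <=
   1 + \sum_(0 <= k <oo) (c k * \1_(survival X U h k) w)%:E)%E.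
Proof.
have nn k : (0 <= (c k * \1_(survival X U h k) w)%:E)%E.
  by rewrite lee_fin mulr_ge0.
have partial n : (forall k, (k < n)%N -> survival X U h k w) ->
    ((x ^+ n)%:E <= 1 + \sum_(0 <= k <oo) (c k * \1_(survival X U h k) w)%:E)%E.
  move=> surv; have -> : x ^+ n = 1 + \sum_(0 <= k < n) c k.
    by rewrite sum_c; ring.
  rewrite EFinD leeD2l//; apply: le_trans (nneseries_lim_ge n _); last by [].
  rewrite -sumEFin !big_mkord; apply: lee_sum => k _.
  by rewrite indicE mem_set ?mulr1//; exact: surv.
have [[n Un]|noU] := pselect (exists n : nat, U (X (n%:R * h) w)).
  have ex : exists n, `[< U (X (n%:R * h) w) >] by exists n; exact/asboolP.
  case: (ex_minnP ex) => m /asboolP Um mmin.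
  apply: le_trans (partial m _); last first.
    move=> k km j jk /asboolP/mmin; apply/negP; rewrite -ltnNge.
    exact: leq_ltn_trans jk km.
  rewrite /x -expRM_natl -[leRHS]/(expeR (m%:R * (theta * h))%:E) lee_expeR.
  rewrite mulrCA EFinM; apply: lee_wpmul2l; first by rewrite lee_fin ltW.
  rewrite /hitting_time.
  apply: ereal_inf_lbound; exists (m%:R * h) => //; split=> //.
  by rewrite mulr_ge0// ltW.
suff -> : (1 + \sum_(0 <= k <oo) (c k * \1_(survival X U h k) w)%:E = +oo)%E.
  by rewrite leey.
have {}partial n := partial n (fun k _ j _ Uj => noU (ex_intro _ j Uj)).
move: partial; case: (1 + _)%E => [r| |] partial //.
- (* x ^+ n = exp(n theta h) exceeds n theta h *)
  exfalso; pose n := (Num.truncn (`|r| / (theta * h))).+1.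
  have := partial n; rewrite lee_fin leNgt => /negP; apply.
  rewrite /x -expRM_natl; apply: lt_le_trans (expR_ge1Dx _).
  apply: (le_lt_trans (ler_norm r)); apply: ltr_wpDl => //.
  by rewrite -ltr_pdivrMr ?mulr_gt0// /n truncnS_gt// divr_ge0// mulr_ge0 ?ltW.
- by have := partial 0%N; rewrite leeNy_eq.
Qed.

(** The series is a measurable majorant, so its integral bounds the upper
    integral. *)
Lemma upper_integral_hitting_time (Q : {measure set Omega -> \bar R})
    (K : \bar R) (q : R) :
  (forall k, measurable (survival X U h k)) -> Q setT = 1%E -> (0 <= K)%E ->
  0 <= q -> x * q < 1 ->
  (forall k, (Q (survival X U h k) <= K * (q ^+ k.+1)%:E)%E) ->
  (upper_integral Q (fun w => expeR (theta%:E * hitting_time X U w)) <=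
   1 + K * ((x - 1) * q / (1 - x * q))%:E)%E.
Proof.
move=> ms QT K0 q0 xq Qs.
pose Z w := (1 + \sum_(0 <= k <oo) (c k * \1_(survival X U h k) w)%:E)%E.
have mterm k :
    measurable_fun setT (fun w => (c k * \1_(survival X U h k) w)%:E).
  by apply/measurable_EFinP/measurable_funM => //; exact: measurable_indic.
have nn k w : (0 <= (c k * \1_(survival X U h k) w)%:E)%E.
  by rewrite lee_fin mulr_ge0.
have msum : measurable_fun setT
    (fun w => \sum_(0 <= k <oo) (c k * \1_(survival X U h k) w)%:E)%E.
  by apply: ge0_emeasurable_sum => // k w _ _; exact: nn.
have mZ : measurable_fun setT Z by apply: emeasurable_funD.
apply: (@le_trans _ _ (\int[Q]_w Z w)%E).
  apply: ereal_inf_lbound; exists Z => //; split=> // w.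
  exact: expeR_hitting_time_le.
rewrite ge0_integralD//; last first.
  by move=> w _; apply: nneseries_ge0 => k _ _; exact: nn.
rewrite integral_cst// QT mule1 leeD2l//.
rewrite integral_nneseries//.
have int k : (\int[Q]_w (c k * \1_(survival X U h k) w)%:E =
    (c k)%:E * Q (survival X U h k))%E.
  under eq_integral do rewrite EFinM.
  rewrite ge0_integralZl_EFin//; last first.
    exact/measurable_EFinP/measurable_indic.
  by rewrite integral_indic// setIT.
apply: lime_le.
  by apply: is_cvg_nneseries => k _ _; apply: integral_ge0 => w _; exact: nn.
apply: nearW => n.
apply: (@le_trans _ _ (\sum_(0 <= k < n) K * (c k * q ^+ k.+1)%:E)%E).
  apply: lee_sum => k _; rewrite int (EFinM (c k) (q ^+ k.+1)) muleCA.
  by rewrite lee_wpmul2l// lee_fin.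
rewrite -ge0_sume_distrr; last first.
  by move=> k _; rewrite lee_fin mulr_ge0// exprn_ge0.
rewrite lee_wpmul2l// sumEFin lee_fin ler_pdivlMr ?subr_gt0//.
have -> : \sum_(0 <= k < n) c k * q ^+ k.+1 =
    (x - 1) * q * \sum_(k < n) (x * q) ^+ k.
  rewrite big_mkord mulr_sumr; apply: eq_bigr => k _.
  by rewrite /c exprMn exprS; ring.
rewrite -[leLHS]mulrA ler_piMr ?mulr_ge0 ?subr_ge0 ?(ltW x1)//.
rewrite mulrC -opprB mulNr -subrX1 opprB gerBl exprn_ge0// mulr_ge0//.
exact/ltW/(lt_trans ltr01).
Qed.

End hitting_time_bound.

Lemma rateE (R : realType) (dE : measure_display) (E : measurableType dE)
    (mu : probability E R) (rho : R) (U : set E) : measurable U ->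
  (0 < mu U)%E ->
  rate mu rho (fun x => - \1_U x) (fine (mu U)) = rho * fine (mu U) / 31.
Proof.
move=> mU U0; have Ufin : mu U \is a fin_num by rewrite fin_num_measure.
have r0 : 0 < fine (mu U) by rewrite fine_gt0// U0 -ge0_fin_numE.
have sqrN : fine (norm2 mu (fun x => - \1_U x)) ^+ 2 = fine (mu U).
  rewrite norm2E (_ : (\int[mu]_x _)%E = mu U).
    by rewrite -(fineK Ufin) poweR_EFin powR12_sqrt ?ltW//= sqr_sqrtr// ltW.
  have := integral_indic mu measurableT mU; rewrite setIT => <-.
  apply: eq_integral => x _.
  by rewrite sqrrN indicE; case: (x \in U); rewrite ?expr1n ?expr0n.
have supN : sup_norm (fun x => - \1_U x : R) = 1.
  have [x Ux] : U !=set0.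
    by apply/set0P/eqP => U00; move: U0; rewrite U00 measure0 ltxx.
  apply/eqP; rewrite eq_le; apply/andP; split.
    apply: sup_le_ub; first by exists `|- \1_U x|, x.
    by move=> _ [y _ <-]; rewrite normrN indicE ger0_norm// lern1 leq_b1.
  apply: ub_le_sup.
    by exists 1 => _ [y _ <-]; rewrite normrN indicE ger0_norm// lern1 leq_b1.
  by exists x => //; rewrite normrN indicE mem_set// normr1.
by rewrite /rate sqrN supN; field; rewrite gt_eqF//; lra.
Qed.

(** Here x = exp(y) with y = 3 theta / rho < 3 r / 31, and the claim reduces to
    (x - 1) rho r / 31 <= theta r / 8. As x - 1 <= y / (1 - y) <= 31 y / 28, the
    left-hand side is at most 3 theta r / 28. *)
Lemma hitting_series_le (R : realType) (rho r theta : R) :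
  0 < rho -> 0 < r <= 1 -> 0 < theta -> theta < rho * r / 31 ->
  let x := expR (theta * (3 / rho)) in let q := (1 + r / 8)^-1 in
  x * q < 1 /\ (x - 1) * q / (1 - x * q) <= theta / (rho * r / 31 - theta).
Proof.
move=> rho0 /andP[r0 r1] th0 thr x q.
set y := theta * (3 / rho).
have y0 : 0 < y by rewrite mulr_gt0// divr_gt0.
have yE : y * rho = 3 * theta by rewrite /y; field; rewrite gt_eqF.
have y3 : y < 3 / 31 * r.
  by rewrite -(ltr_pM2r rho0) yE; lra.
have x1 : (x - 1) * (1 - y) <= y.
  have : (1 - y) * x <= 1.
    rewrite -ler_pdivlMr ?expR_gt0// div1r -expRN.
    by have := expR_ge1Dx (- y); rewrite addrC.
  lra.
have x1' : (x - 1) * 28 <= 31 * y.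
  have x0 : 0 <= x - 1 by rewrite subr_ge0 ltW // expR_gt1.
  have : (x - 1) * (28 / 31) <= (x - 1) * (1 - y).
    by rewrite ler_wpM2l//; lra.
  by lra.
have d0 : 0 < 1 + r / 8 by lra.
have xd : x < 1 + r / 8 by lra.
have xq : x * q < 1 by rewrite ltr_pdivrMr// mul1r.
split=> //.
rewrite (_ : (x - 1) * q / (1 - x * q) = (x - 1) / (1 + r / 8 - x)); last first.
  rewrite /q; field.
  by rewrite !gt_eqF//; lra.
rewrite ler_pdivrMr ?subr_gt0// mulrAC ler_pdivlMr ?subr_gt0//.
suff : (x - 1) * (rho * r / 31) <= theta * (r / 8) by lra.
have : (x - 1) * 28 * (rho * r) <= 31 * y * (rho * r).
  by rewrite ler_wpM2r// mulr_ge0 ?ltW.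
rewrite (_ : 31 * y * (rho * r) = 31 * r * (y * rho)); last by ring.
rewrite yE.
have : 0 <= theta * r by rewrite mulr_ge0 ?ltW.
by lra.
Qed.

Theorem mainTheorem2 (R : realType) (E : ptopologicalType) (polishE : polish R E)
    (dO : measure_display) (Omega : measurableType dO)
    (X : R -> Omega -> borel E) (P : R.-pker (borel E) ~> Omega)
    (mu : probability (borel E) R)
    (markovX : markov_process X P) (invmu : invariant_measure X P mu)
    (closedL : closed_graph (L2_generator X P mu))
    (denseL : dense_domain (L2_generator X P mu))
    (rho : R) (rho_gt0 : 0 < rho) (S : L2 mu -> L2 mu)
    (linS : linear_operator S) (boundedS : bounded_operator S)
    (symS : symmetric_operator S)
    (normS : forall f Lf : L2 mu, L2_generator X P mu f Lf ->
      (norm2 mu (S f) <= (1 / 2)%:E * norm2 mu (centered mu f))%E)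
    (hypocoercive : forall f Lf : L2 mu, L2_generator X P mu f Lf ->
      ((dot mu f (Lf + S Lf)%R)%:E <=
        (- rho)%:E * norm2 mu (centered mu f) ^+ 2)%E)
    (U : set (borel E)) (measU : measurable U) (muU_gt0 : (0 < mu U)%E)
    (theta : R) (theta_ge0 : 0 <= theta)
    (theta_lt : theta < rate mu rho (fun x => - \1_U x) (fine (mu U)))
    (nu : probability (borel E) R) (nu_mu : nu `<< mu) :
  (upper_integral (started_from nu P)
     (fun w => expeR (theta%:E * hitting_time X U w)) <=
   1 + (Num.sqrt 2)%:E
       * 'N[mu]_2%:E['d (charge_of_finite_measure nu) '/d mu]
       * (theta / (rate mu rho (fun x => - \1_U x) (fine (mu U)) - theta))%:E)%E.
Proof.
have QT : started_from nu P setT = 1%E.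
  rewrite /started_from; under eq_integral do rewrite prob_kernel.
  rewrite integral_cst// mul1e. exact: probability_setT.
rewrite rateE// in theta_lt *.
set K := ('N[mu]_2%:E['d _ '/d _])%E; have K0 : (0 <= K)%E := Lnorm_ge0 _ _ _.
have Ufin : mu U \is a fin_num by rewrite fin_num_measure.
set r := fine (mu U) in theta_lt *.
have r0 : 0 < r by rewrite fine_gt0// muU_gt0 -ge0_fin_numE.
have r1 : r <= 1 by rewrite -lee_fin fineK// probability_le1.
have [theta0|theta_neq0] := eqVneq theta 0.
  rewrite theta0 mul0r mule0 adde0 -[leRHS]QT -[leRHS]mul1e -integral_cst//.
  apply: ereal_inf_lbound; exists (cst 1%E) => //; split=> // w.
  by rewrite mul0e expeR0.
have theta_gt0 : 0 < theta by rewrite lt_neqAle eq_sym theta_neq0.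
have h_gt0 : 0 < 3 / rho by rewrite divr_gt0.
have [|xq bound] := hitting_series_le rho_gt0 _ theta_gt0 theta_lt.
  by rewrite r0.
have contraction f := hypocoercive_contraction markovX invmu denseL rho_gt0 linS
  boundedS symS normS hypocoercive (ltW h_gt0) f erefl.
apply: le_trans (upper_integral_hitting_time h_gt0 theta_gt0 _ QT K0 _ xq _) _.
- by move=> k; exact: (measurable_survival markovX measU (ltW h_gt0)).
- by rewrite invr_ge0; lra.
- by move=> k; exact: (started_from_survival measU contraction).
rewrite leeD2l// -muleA -[leLHS]mul1e; apply: lee_pmul => //.
- rewrite mule_ge0// lee_fin divr_ge0//; last by rewrite subr_ge0 ltW.
  rewrite mulr_ge0// ?invr_ge0; last by lra.
  by rewrite subr_ge0 ltW// expR_gt1 mulr_gt0.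
- by rewrite lee_fin -{1}sqrtr1 ler_sqrt//; lra.
- by rewrite lee_wpmul2l.
Qed.
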